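(* Let $q\in\mathbb N$ be fixed, and let $K_1\hookrightarrow K_2\hookrightarrow\cdots\hookrightarrow K_m$ be a simplicial filtration where each $K_{t+1}$ contains exactly one more simplex than $K_t$ for all $t\in\{1,\dots,m-1\}$. For any fixed $t\in\{1,\dots,m\}$, the whole set $\{\boldsymbol{\Delta}_q^{s,t}\}_{s=1}^t$ of matrix representations of persistent Laplacians can be computed in $O\left(t\,(n_q^t)^2+n_{q+1}^t\right)$ time. Consequently, all $\boldsymbol{\Delta}_q^{i,j}$, for $1\le i\le j\le m$, can be computed in $O\left(m^2\,(n_q^m)^2+m\,n_{q+1}^m\right)$ total time.
   Context: A simplicial complex $K$ over a finite totally ordered set $V$ is a collection of nonempty subsets of $V$ closed under taking nonempty subsets. $S_q^K$ is the set of $q$-simplices (elements of cardinality $q+1$). Every complex $K$ carries a weight function $w^K:K\to(0,\infty)$. For $\sigma\in S_q^K$, $[\sigma]$ is $\sigma$ oriented by the order of $V$. $C_q^K$ is the real vector space with basis $\{[\sigma]:\sigma\in S_q^K\}$ (and $C_{-1}^K=0$), with the inner product $\langle[\sigma],[\sigma']\rangle=\delta_{\sigma\sigma'}\,(w^K(\sigma))^{-1}$. The boundary operator is $\partial_q^K[v_0,\dots,v_q]=\sum_{i=0}^q(-1)^i[v_0,\dots,\hat v_i,\dots,v_q]$ for $q\ge1$, and $\partial_0^K=0$. A simplicial pair $K\hookrightarrow L$ consists of simplicial complexes $K\subseteq L$ over the same $V$ with $w^K=w^L|_K$. Put $C_{q}^{L,K}=\{c\in C_q^L:\partial_q^L c\in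 C_{q-1}^K\}$, with the inner product restricted from $C_q^L$, and let $\partial_q^{L,K}:C_q^{L,K}\to C_{q-1}^K$ be the restriction of $\partial_q^L$. The persistent Laplacian is $\Delta_q^{K,L}=\partial_{q+1}^{L,K}(\partial_{q+1}^{L,K})^*+(\partial_q^K)^*\partial_q^K$ on $C_q^K$ ($*$ denotes adjoint). In a simplicial filtration, $K_s\hookrightarrow K_t$ is a simplicial pair for all $s\le t$. Write $n_q^t=|S_q^{K_t}|$, and let $\boldsymbol{\Delta}_q^{s,t}$ be the matrix of $\Delta_q^{K_s,K_t}$ in the basis of oriented $q$-simplices of $K_s$ (the $q$-simplices are ordered compatibly with the filtration). The input is the filtration, given by its boundary matrices (in dimensions $q$ and $q+1$) and its weights. Time is the number of elementary operations, with each exact real arithmetic operation or comparison costing $O(1)$; the dimension $q$ is treated as a constant, so implied constants may depend on $q$. *)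

(* Defs.v *)
From mathcomp Require Import all_boot all_order all_algebra.
From mathcomp Require classical_sets.
From mathcomp Require Import reals.

Set Implicit Arguments.
Unset Strict Implicit.
Unset Printing Implicit Defensive.

Import Order.TTheory GRing.Theory Num.Theory.
Local Open Scope ring_scope.

(** * Weighted simplicial complexes, chains and the persistent Laplacian

    Everything graded by dimension is indexed by the number [c] of vertices:
    dimension q is [c = q.+1].  In particular [simplices K 0] is empty, so that
    [chains K 0] is the zero space C_{-1}^K. *)

Record wcomplex (R : realType) (d : Order.disp_t) (V : finOrderType d) :=
  WComplex {
    simp : {set {set V}};
    (* only the values on [simp] are meaningful *)
    weight : {set V} -> R;
    simp_nonempty : set0 \notin simp;
    simp_closed : forall s s' : {set V},
      s \in simp -> s' \subset s -> s' != set0 -> s' \in simp;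
    weight_gt0 : forall s : {set V}, s \in simp -> 0 < weight s
  }.

Section Laplacian.
Variables (R : realType) (d : Order.disp_t) (V : finOrderType d).
Implicit Types (K L : wcomplex R V) (s : {set V}).

Definition simplices K (c : nat) : {set {set V}} :=
  [set s in simp K | #|s| == c]%SET.

Definition simplicial_pair K L : Prop :=
  simp K \subset simp L /\ (forall s, s \in simp K -> weight K s = weight L s).

(** Chains of all complexes over V and of all dimensions live in one ambient
    space, with basis the [cbasis s]; this makes the inclusions C_q^K <= C_q^L
    genuine inclusions. *)
Definition chain := {ffun {set V} -> R^o}.

Definition cbasis s : chain := [ffun s' => (s' == s)%:R].

Definition chains K (c : nat) (x : chain) : Prop :=
  forall s, s \notin simplices K c -> x s = 0.

Definition inner K (x y : chain) : R :=
  \sum_(s in simp K) (weight K s)^-1 * (x s * y s).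

(** The i with v = v_i when s = {v_0 < ... < v_q}. *)
Definition vpos s (v : V) : nat := #|[set u in s | (u < v)%O]%SET|.

Definition boundary1 s : chain :=
  if (#|s| <= 1)%N then 0
  else \sum_(v in s) (-1) ^+ vpos s v *: cbasis (s :\ v).

Definition boundary (x : chain) : chain := \sum_s x s *: boundary1 s.

(** C_q^{L,K}, with c = q.+1. *)
Definition pair_chains K L (c : nat) (x : chain) : Prop :=
  chains L c x /\ chains K c.-1 (boundary x).

(** The adjoint of [f : U -> W], where U and W carry the inner products of L and
    K, at a vector [y] of W: the unique x in U such that <u, x>_L = <f u, y>_K
    for all u in U. *)
Definition adjoint L K (U : chain -> Prop) (f : chain -> chain) (y : chain) :
    chain :=
  classical_sets.xget 0 (fun x => U x /\ forall u, U u -> inner L u x = inner K (f u) y).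

Definition laplacian (q : nat) K L (x : chain) : chain :=
  boundary (adjoint L K (pair_chains K L q.+2) boundary x)
  + adjoint K K (chains K q.+1) boundary (boundary x).

(** ** Filtrations K_1, ..., K_m and their matrices *)

Definition filtration (m : nat) (K : nat -> wcomplex R V) : Prop :=
  [/\ (0 < m)%N,
      forall s t : nat, (1 <= s <= t)%N -> (t <= m)%N -> simplicial_pair (K s) (K t)
    & forall t, (1 <= t < m)%N -> #|simp (K t.+1)| = #|simp (K t)|.+1].

(** [o c] lists the simplices of K_m with c vertices in an order compatible with
    the filtration: those of each K_t form an initial segment. *)
Definition compatible (m : nat) (K : nat -> wcomplex R V)
    (o : nat -> seq {set V}) : Prop :=
  forall c, perm_eq (o c) (enum (simplices (K m) c)) /\
    forall t, (1 <= t <= m)%N ->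
      take #|simplices (K t) c| (o c) =i simplices (K t) c.

Definition laplacian_mx (q : nat) K L (l : seq {set V}) :
    'M[R]_#|simplices K q.+1| :=
  \matrix_(i, j) laplacian q K L (cbasis (nth set0 l j)) (nth set0 l i).

Definition boundary_mx K (o : nat -> seq {set V}) (c : nat) :
    'M[R]_(#|simplices K c.-1|, #|simplices K c|) :=
  \matrix_(i, j) boundary (cbasis (nth set0 (o c) j)) (nth set0 (o c.-1) i).

End Laplacian.

(** * A real RAM

    Finitely many program variables and unbounded arrays, holding either natural
    numbers or real numbers.  Array cells are indexed by natural numbers, which
    can only be added, (truncatedly) subtracted and compared.  Reals support
    exact field operations, with x / 0 = 0, and comparisons; there is no
    conversion from reals to naturals.  Variables and arrays are named by
    numbers. *)

Inductive nexp :=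
  | NConst of nat
  | NVar of nat
  | NGet of nat & nexp
  | NAdd of nexp & nexp
  | NSub of nexp & nexp.

Inductive rexp :=
  | RConst of nat
  | RVar of nat
  | RGet of nat & nexp
  | RAdd of rexp & rexp
  | RSub of rexp & rexp
  | RMul of rexp & rexp
  | RDiv of rexp & rexp.

Inductive test :=
  | NEq of nexp & nexp
  | NLt of nexp & nexp
  | REq of rexp & rexp
  | RLt of rexp & rexp.

Inductive com :=
  | Skip
  | NSet of nat & nexp
  | NPut of nat & nexp & nexp
  | RSet of nat & rexp
  | RPut of nat & nexp & rexp
  | Seq of com & com
  | If of test & com & com
  | While of test & com.

Record state (R : realType) := State {
  nvar : nat -> nat;
  rvar : nat -> R;
  narr : nat -> nat -> nat;
  rarr : nat -> nat -> R
}.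

Definition upd (T : Type) (f : nat -> T) (x : nat) (v : T) : nat -> T :=
  fun y => if y == x then v else f y.

(** Costs: one unit for each constant, variable access, array access and
    operation. *)

Fixpoint ncost (e : nexp) : nat :=
  match e with
  | NConst _ | NVar _ => 1
  | NGet _ e1 => (ncost e1).+1
  | NAdd e1 e2 | NSub e1 e2 => (ncost e1 + ncost e2).+1
  end.

Fixpoint rcost (e : rexp) : nat :=
  match e with
  | RConst _ | RVar _ => 1
  | RGet _ e1 => (ncost e1).+1
  | RAdd e1 e2 | RSub e1 e2 | RMul e1 e2 | RDiv e1 e2 =>
      (rcost e1 + rcost e2).+1
  end.

Definition tcost (b : test) : nat :=
  match b with
  | NEq e1 e2 | NLt e1 e2 => (ncost e1 + ncost e2).+1
  | REq e1 e2 | RLt e1 e2 => (rcost e1 + rcost e2).+1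
  end.

Section Semantics.
Variable R : realType.
Implicit Type st : state R.

Fixpoint neval st (e : nexp) : nat :=
  match e with
  | NConst n => n
  | NVar x => nvar st x
  | NGet a e1 => narr st a (neval st e1)
  | NAdd e1 e2 => (neval st e1 + neval st e2)%N
  | NSub e1 e2 => (neval st e1 - neval st e2)%N
  end.

Fixpoint reval st (e : rexp) : R :=
  match e with
  | RConst n => n%:R
  | RVar x => rvar st x
  | RGet a e1 => rarr st a (neval st e1)
  | RAdd e1 e2 => reval st e1 + reval st e2
  | RSub e1 e2 => reval st e1 - reval st e2
  | RMul e1 e2 => reval st e1 * reval st e2
  | RDiv e1 e2 => reval st e1 / reval st e2
  end.

Definition teval st (b : test) : bool :=
  match b with
  | NEq e1 e2 => neval st e1 == neval st e2
  | NLt e1 e2 => (neval st e1 < neval st e2)%N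
  | REq e1 e2 => reval st e1 == reval st e2
  | RLt e1 e2 => reval st e1 < reval st e2
  end.

Definition set_nvar st x v :=
  State (upd (nvar st) x v) (rvar st) (narr st) (rarr st).
Definition set_rvar st x v :=
  State (nvar st) (upd (rvar st) x v) (narr st) (rarr st).
Definition set_narr st a i v :=
  State (nvar st) (rvar st) (upd (narr st) a (upd (narr st a) i v)) (rarr st).
Definition set_rarr st a i v :=
  State (nvar st) (rvar st) (narr st) (upd (rarr st) a (upd (rarr st a) i v)).

(** [exec p st k st']: started in [st], the program [p] terminates in [st'] after
    [k] elementary operations. *)
Inductive exec : com -> state R -> nat -> state R -> Prop :=
  | ExecSkip st : exec Skip st 0 st
  | ExecNSet st x e :
      exec (NSet x e) st (ncost e).+1 (set_nvar st x (neval st e))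
  | ExecNPut st a i e :
      exec (NPut a i e) st (ncost i + ncost e).+1
        (set_narr st a (neval st i) (neval st e))
  | ExecRSet st x e :
      exec (RSet x e) st (rcost e).+1 (set_rvar st x (reval st e))
  | ExecRPut st a i e :
      exec (RPut a i e) st (ncost i + rcost e).+1
        (set_rarr st a (neval st i) (reval st e))
  | ExecSeq st st1 st2 p1 p2 k1 k2 :
      exec p1 st k1 st1 -> exec p2 st1 k2 st2 ->
      exec (Seq p1 p2) st (k1 + k2) st2
  | ExecIf st st1 b p1 p2 k :
      exec (if teval st b then p1 else p2) st k st1 ->
      exec (If b p1 p2) st (tcost b + k) st1
  | ExecWhileStop st b p :
      ~~ teval st b -> exec (While b p) st (tcost b) st
  | ExecWhileStep st st1 st2 b p k1 k2 :
      teval st b -> exec p st k1 st1 -> exec (While b p) st1 k2 st2 ->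
      exec (While b p) st (tcost b + k1 + k2) st2.

End Semantics.

(** * Input and output conventions *)

(** Names of variables and arrays.  The argument e = 0, 1, 2 stands for dimension
    q - 1, q, q + 1 (that is, q + e vertices). *)
Definition var_m : nat := 0.
Definition var_t : nat := 1.
Definition arr_count (e : nat) : nat := e.
Definition arr_row (e : nat) : nat := (3 + e)%N.
Definition arr_weight (e : nat) : nat := e.
Definition arr_val (e : nat) : nat := (3 + e)%N.
Definition arr_out : nat := 6.

Section InputOutput.
Variables (R : realType) (d : Order.disp_t) (V : finOrderType d).
Implicit Type st : state R.

(** The array pair ([row], [val]) is a sparse representation of [B] by columns,
    with [k] stored entries per column: entry l of column j is stored at
    j * k + l. *)
Definition sparse_columns (row : nat -> nat) (val : nat -> R) (k r n : nat)
    (B : 'M[R]_(r, n)) : Prop :=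
  forall j : 'I_n,
    (forall l : 'I_k, (row (j * k + l) < r)%N) /\
    (forall i : 'I_r,
       B i j = \sum_(l < k | row (j * k + l)%N == i) val (j * k + l)%N).

(** Number of nonzero entries in each column of the boundary matrix of simplices
    with c vertices. *)
Definition nfacets (c : nat) : nat := if (c <= 1)%N then 0%N else c.

(** The memory cells which are not mentioned have arbitrary contents.  The
    numbers n_p^s determine which simplices of the lists [o] belong to K_s. *)
Definition holds_input (q m : nat) (K : nat -> wcomplex R V)
    (o : nat -> seq {set V}) st : Prop :=
  [/\ nvar st var_m = m,
      forall e s, (e <= 2)%N -> (1 <= s <= m)%N ->
        narr st (arr_count e) s = #|simplices (K s) (q + e)|,
      forall e i, (e <= 2)%N -> (i < #|simplices (K m) (q + e)|)%N ->
        rarr st (arr_weight e) i = weight (K m) (nth set0 (o (q + e)%N) i)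
    & forall e, (1 <= e <= 2)%N ->
        sparse_columns (narr st (arr_row e)) (rarr st (arr_val e))
          (nfacets (q + e)) (boundary_mx (K m) o (q + e))].

(** The matrix [M] is stored by rows of length [w] in the output array, from
    address [a] on. *)
Definition holds_matrix st (a w n : nat) (M : 'M[R]_n) : Prop :=
  forall i j : 'I_n, rarr st arr_out (a + i * w + j)%N = M i j.

End InputOutput.

(** The meaning of "O(f) time".  Here f vanishes only when there is no q-simplex,
    in which case all the matrices are empty but a program still has to find this
    out; otherwise the bound is [C * f]. *)
Definition time_bound (C f k : nat) : Prop := (k <= C * maxn 1 f)%N.

(* Main.v *)
Require Import Defs.
From mathcomp Require Import all_boot all_order all_algebra.
From mathcomp Require classical_sets.
From mathcomp Require Import reals.
From mathcomp Require Import zify ring.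

(** Write K = K_s and L = K_t, let B be the matrix of the boundary operator from
    the (q+1)-simplices to the q-simplices of L, and U, W the diagonal matrices
    of the weights of these simplices.  The up-Laplacian of L has the matrix
    M W^-1, where M = B U B^T is a Gram matrix.

    The up-part of the persistent Laplacian sends y to the boundary of the
    adjoint of y in C_{q+1}^{L,K}.  Suppose that y' extends y to the q-simplices
    of L in such a way that the up-Laplacian of L sends y' into C_q^K.  Then the
    coboundary of y' lies in C_{q+1}^{L,K}, and pairing it with an element u of
    that space only sees the values of y' on K, because the boundary of u lies
    in K; so it is the adjoint of y ([up_adjoint]).  Finding such a y' means
    eliminating the unknowns outside K, that is, taking the Schur complement of
    M on the rows and columns of K ([reduces], [up_entry]).

    When s decreases by one, at most one q-simplex disappears, and it is the last
    one of the list.  Hence the Schur complement for s arises from the one for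
    s + 1 by a single pivot, in quadratic time ([reduces_schur]).  If the pivot
    is zero then so is its whole column, since M is a Gram matrix
    ([zero_pivot]); with x / 0 = 0 the same formula is then right again.

    The boundary of a simplex has boundedly many nonzero coefficients.  So M is
    assembled by (q+2)^2 updates per (q+1)-simplex, which gives the term n_{q+1},
    and an entry of the down-Laplacian is a sum of at most (q+1)^2 terms.  A
    sweep over s = t, ..., 1 therefore costs O(t n_q^2 + n_{q+1})
    ([runs_sweep]); all the pairs (i, j) are obtained by sweeping from each j.

    Programs are verified as follows.  Programs without loops are interpreted by
    a function and have a static cost bound ([runs_sem]); loops are handled by
    an invariant ([runs_for]); what a program leaves unchanged is read off from
    its text ([within], [exec_agree]), so that invariants only speak of the cells
    being computed. *)

Set Implicit Arguments.
Unset Strict Implicit.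
Unset Printing Implicit Defensive.

Import Order.TTheory GRing.Theory Num.Theory.
Local Open Scope ring_scope.

(** * Iterated Schur complements of a Gram matrix *)

Section Schur.
Variable F : realFieldType.
Implicit Types (M S : nat -> nat -> F) (g h : nat -> F).

Definition mulv n S h i := \sum_(k < n) S i k * h k.

Definition msym n S := forall i j, (i < n)%N -> (j < n)%N -> S i j = S j i.

(** [S] is the Schur complement of [M] on the first [n] of [N] indices, expressed
    by what it does: any prescribed values [h] on the first [n] indices extend to
    a vector whose image under [M] vanishes on the other indices and is [S h] on
    the first ones.  Unlike the formula with the inverse of a block, this makes
    sense for singular blocks and composes along successive eliminations. *)
Definition reduces M N n S := msym n S /\
  forall h, exists2 g, (forall i, (i < n)%N -> g i = h i)
    & forall i, (i < N)%N -> mulv N M g i = if (i < n)%N then mulv n S h i else 0.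

(** For a semidefinite matrix this says that an isotropic vector lies in the
    kernel, the form in which semidefiniteness enters the elimination. *)
Definition null_isotropic N M := forall g,
  \sum_(i < N) g i * mulv N M g i = 0 -> forall i, (i < N)%N -> mulv N M g i = 0.

Definition schur n S i j := S i j - S i n * S n j / S n n.

Lemma reduces_refl M N : msym N M -> reduces M N N M.
Proof. by move=> symM; split=> // h; exists h => // i ->. Qed.

(** The two matrices need only agree on the index range, which allows the
    coefficients computed from the memory in place of the mathematical ones. *)
Lemma reduces_gram M M' N n S :
  (forall i j, (i < N)%N -> (j < N)%N -> M' i j = M i j) ->
  reduces M N n S -> reduces M' N n S.
Proof.
move=> eqM [symS redS]; split=> // h; have [g gh Mg] := redS h.
exists g => // i ltiN; rewrite -Mg //.
by apply: eq_bigr => k _; rewrite eqM.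
Qed.

(** Extend the last unit vector to g with M g = (S e_n, 0).  Then the quadratic
    form of M at g is the pivot [S n n]; if it vanishes then M g = 0, so the
    column S e_n is zero. *)
Lemma zero_pivot M N n S : null_isotropic N M -> (n < N)%N ->
  reduces M N n.+1 S -> S n n = 0 -> forall i, (i <= n)%N -> S i n = 0.
Proof.
move=> isoM ltnN [symS redS] Snn0.
have mulvE i : mulv n.+1 S (fun k => (k == n)%:R) i = S i n.
  rewrite /mulv big_ord_recr /= eqxx mulr1 big1 ?add0r // => k _.
  by rewrite (ltn_eqF (ltn_ord k)) mulr0.
have [g gh Mg] := redS (fun k => (k == n)%:R).
have Mg0 : forall i, (i < N)%N -> mulv N M g i = 0.
  apply: isoM; apply: big1 => i _; rewrite Mg // mulvE.
  case: ltnP => [|_]; last by rewrite mulr0.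
  rewrite ltnS leq_eqVlt => /predU1P[->|ltin]; first by rewrite Snn0 mulr0.
  by rewrite gh ?leqW // (ltn_eqF ltin) mul0r.
move=> i lein; have := Mg0 i (leq_ltn_trans lein ltnN).
by rewrite Mg ?(leq_ltn_trans lein ltnN) // ltnS lein mulvE.
Qed.

(** Give the eliminated index the value - (row n of S) h / S n n, which makes the
    image vanish there.  With a zero pivot this value is 0, and the image at [n]
    vanishes by [zero_pivot] and symmetry. *)
Lemma reduces_schur M N n S : null_isotropic N M -> (n < N)%N ->
  reduces M N n.+1 S -> reduces M N n (schur n S).
Proof.
move=> isoM ltnN redS; have Sn0 := zero_pivot isoM ltnN redS.
have [symS] := redS; move=> exS; split=> [i j ltin ltjn|h].
  rewrite /schur (symS i j) 1?(symS i n) 1?(symS n j) ?ltnS // 1?ltnW //.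
  by congr (_ - _ / _); rewrite mulrC.
(* This also covers a zero pivot, for which the value at n is 0. *)
pose h' k := if (k < n)%N then h k else - (mulv n S h n / S n n).
have mulh' i : mulv n.+1 S h' i = mulv n S h i - S i n * mulv n S h n / S n n.
  rewrite /mulv big_ord_recr /= /h' ltnn mulrN mulrA; congr (_ - _ * _ / _).
  by apply: eq_bigr => k _; rewrite ltn_ord.
have [g gh Mg] := exS h'; exists g => [i ltin|i ltiN].
  by rewrite (gh i (leqW ltin)) /h' ltin.
rewrite Mg // mulh' ltnS; case: ltngtP => // [ltin|->].
  rewrite /mulv mulr_sumr mulr_suml -sumrB; apply: eq_bigr => k _.
  by rewrite /schur mulrBl; congr (_ - _); ring.
have [Snn0|Snn_neq0] := eqVneq (S n n) 0.
  rewrite Snn0 invr0 mulr0 subr0 /mulv big1 // => k _.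
  have ltkn : (k < n)%N by [].
  by rewrite (symS n k (ltnSn n) (leqW ltkn)) (Sn0 Snn0 k (ltnW ltkn)) mul0r.
by rewrite [S n n * _]mulrC mulfK // subrr.
Qed.

(** The quadratic form is the sum of the w_k (sum_i b_ik g_i)^2, so all its terms
    vanish with it, and M g is a combination of the quantities
    w_k (sum_i b_ik g_i). *)
Lemma gram_null_isotropic N p M (w : nat -> F) (b : nat -> nat -> F) :
  (forall k, (k < p)%N -> 0 <= w k) ->
  (forall i j, (i < N)%N -> (j < N)%N ->
     M i j = \sum_(k < p) w k * (b i k * b j k)) ->
  null_isotropic N M.
Proof.
move=> w_ge0 Mdef g.
pose c k := \sum_(i < N) b i k * g i.
have MgE i : (i < N)%N -> mulv N M g i = \sum_(k < p) w k * (b i k * c k).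
  move=> ltiN; rewrite /mulv.
  under eq_bigr => j _ do rewrite Mdef // mulr_suml.
  rewrite exchange_big; apply: eq_bigr => k _; rewrite /c !mulr_sumr.
  by apply: eq_bigr => j _; rewrite !mulrA.
have -> : \sum_(i < N) g i * mulv N M g i = \sum_(k < p) w k * c k ^+ 2.
  under eq_bigr => i _ do rewrite MgE // mulr_sumr.
  rewrite exchange_big; apply: eq_bigr => k _ /=.
  rewrite expr2 {2}/c mulr_suml mulr_sumr; apply: eq_bigr => i _; ring.
move=> sum0 i ltiN; rewrite MgE // big1 // => k _.
have wc_ge0 (k' : 'I_p) : true -> 0 <= w k' * c k' ^+ 2.
  by rewrite mulr_ge0 ?sqr_ge0 ?w_ge0.
have /eqP : w k * c k ^+ 2 = 0 by apply: (psumr_eq0P wc_ge0 sum0).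
by rewrite mulf_eq0 expf_eq0 /= => /orP[]/eqP->; rewrite ?mul0r // !mulr0.
Qed.

End Schur.

(** * The persistent Laplacian as a Schur complement *)

Section PersistentLaplacian.
Variables (R : realType) (d : Order.disp_t) (V : finOrderType d).
Implicit Types (K L : wcomplex R V) (s : {set V}) (x y u : chain R V).

Lemma boundaryE x s : boundary x s = \sum_t x t * boundary1 R t s.
Proof. by rewrite /boundary sum_ffunE; apply: eq_bigr => t _; rewrite ffunE. Qed.

Lemma boundary_cbasis s : boundary (cbasis R s) = boundary1 R s.
Proof.
apply/ffunP => t; rewrite boundaryE (bigD1 s) //= ffunE eqxx mul1r big1 ?addr0 //.
by move=> t' /negPf ne; rewrite ffunE ne mul0r.
Qed.

Lemma boundaryB x y : boundary (x - y) = boundary x - boundary y.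
Proof.
apply/ffunP => s; rewrite !ffunE !boundaryE -sumrB; apply: eq_bigr => t _.
by rewrite !ffunE mulrBl.
Qed.

(** This gives both that the boundary matrix of a complex has no entry outside
    the complex and that sums over faces may be taken in any larger complex. *)
Lemma boundary1_supp K c s t :
  s \in simplices K c -> t \notin simplices K c.-1 -> boundary1 R s t = 0.
Proof.
rewrite !inE => /andP[sK /eqP sc] tK; rewrite /boundary1; case: leqP => [_|c_gt1].
  by rewrite ffunE.
rewrite sum_ffunE big1 // => v vs; rewrite !ffunE; case: eqP => [ts|_]; last by rewrite scaler0.
have card_t : #|t| = c.-1 by rewrite -sc (cardsD1 v s) vs ts.
case/negP: tK; rewrite card_t eqxx andbT; apply: (simp_closed sK).
  by rewrite ts subsetDl.
by rewrite -card_gt0 card_t; lia.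
Qed.

Lemma chainsB K c x y : chains K c x -> chains K c y -> chains K c (x - y).
Proof. by move=> Kx Ky s sK; rewrite !ffunE Kx // Ky // subr0. Qed.

Lemma pair_chainsB K L c x y :
  pair_chains K L c x -> pair_chains K L c y -> pair_chains K L c (x - y).
Proof.
move=> [Lx Kx] [Ly Ky]; split; first exact: chainsB.
by rewrite boundaryB; apply: chainsB.
Qed.

Lemma innerBr K u x y : inner K u (x - y) = inner K u x - inner K u y.
Proof.
by rewrite /inner -sumrB; apply: eq_bigr => s _; rewrite !ffunE /=; ring.
Qed.

Lemma inner_eq0 K c x : chains K c x -> inner K x x = 0 -> x = 0.
Proof.
move=> Kx /eqP; rewrite psumr_eq0 => [/allP x0|s sK]; last first.
  by rewrite mulr_ge0 -?expr2 ?sqr_ge0 // invr_ge0 ltW // weight_gt0.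
apply/ffunP => s; rewrite ffunE; have [sK|sK] := boolP (s \in simp K).
  have := x0 s (mem_index_enum s); rewrite sK -expr2 mulf_eq0 invr_eq0 expf_eq0 /=.
  by rewrite (gt_eqF (weight_gt0 sK)) => /eqP.
by apply: Kx; rewrite inE (negPf sK).
Qed.

(** The difference of two candidates is in [U] and orthogonal to [U], hence to
    itself; so the choice in the definition of the adjoint is forced. *)
Lemma adjointE L K c (U : chain R V -> Prop) f y x :
  (forall u, U u -> chains L c u) ->
  (forall u u', U u -> U u' -> U (u - u')) ->
  U x -> (forall u, U u -> inner L u x = inner K (f u) y) ->
  adjoint L K U f y = x.
Proof.
move=> UL UB Ux adj_x; apply: classical_sets.xget_unique => // x' [Ux' adj_x'].
apply/eqP; rewrite -subr_eq0; apply/eqP.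
have Ud : U (x' - x) by apply: UB.
apply: (inner_eq0 (UL _ Ud)); first by rewrite innerBr adj_x' // adj_x // subrr.
Qed.

(** The adjoint of the boundary operator for the weighted inner products of one
    complex, as an explicit formula. *)
Definition coboundary L c y : chain R V :=
  [ffun t => if t \in simplices L c
             then weight L t * \sum_(s in simp L) (weight L s)^-1 * (boundary1 R t s * y s)
             else 0].

Lemma chains_coboundary L c y : chains L c (coboundary L c y).
Proof. by move=> s /negPf sL; rewrite ffunE sL. Qed.

Lemma inner_coboundary L c u y :
  chains L c u -> inner L u (coboundary L c y) = inner L (boundary u) y.
Proof.
move=> Lu; transitivity (\sum_t \sum_(s in simp L)
    u t * ((weight L s)^-1 * (boundary1 R t s * y s))).
  rewrite /inner big_mkcond; apply: eq_bigr => t _; rewrite ffunE -mulr_sumr.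
  have [tL|tL] := boolP (t \in simplices L c); last first.
    by rewrite (Lu _ tL) !mul0r mulr0 if_same.
  have tL' : t \in simp L by move: tL; rewrite inE => /andP[].
  by rewrite tL' [u t * _]mulrCA mulKf // gt_eqF // weight_gt0.
rewrite exchange_big; apply: eq_bigr => s _ /=.
rewrite boundaryE mulr_suml mulr_sumr; apply: eq_bigr => t _; ring.
Qed.

Lemma down_adjoint K c x :
  adjoint K K (chains K c) (@boundary R d V) (boundary x) = coboundary K c (boundary x).
Proof.
apply: (@adjointE _ _ c) => //; first exact: chainsB.
  exact: chains_coboundary.
by move=> u Ku; rewrite inner_coboundary.
Qed.

(** The coboundary of [y'] is in C^{L,K} by the last hypothesis.  The inner
    product of [boundary u] with [y'] is the one with [y], since [boundary u] is
    supported in [K], where both the weights and the two chains agree. *)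
Lemma up_adjoint K L c y y' : simplicial_pair K L ->
  (forall s, s \in simplices K c -> y' s = y s) ->
  chains K c (boundary (coboundary L c.+1 y')) ->
  adjoint L K (pair_chains K L c.+1) (@boundary R d V) y = coboundary L c.+1 y'.
Proof.
move=> [sKL wKL] yy' Kz; apply: (@adjointE _ _ c.+1) => [u []//|u u'||u [Lu Ku]].
- exact: pair_chainsB.
- by split=> //; apply: chains_coboundary.
rewrite inner_coboundary // /inner; rewrite [RHS]big_mkcond [LHS]big_mkcond.
apply: eq_bigr => s _; have [sK|sK] := boolP (s \in simplices K c).
  have [sK' _] : s \in simp K /\ True by move: sK; rewrite inE => /andP[].
  by rewrite sK' (subsetP sKL) // wKL // yy'.
by rewrite (Ku s sK) !mul0r !mulr0 !if_same.
Qed.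

(** The simplices of [K] with [c] vertices are an initial segment of [l], so that
    the position of a simplex does not depend on the complex of the filtration
    in which it is considered. *)
Definition listing K c (l : seq {set V}) :=
  uniq l /\ take #|simplices K c| l =i simplices K c.

Section Listing.
Variables (K : wcomplex R V) (c : nat) (l : seq {set V}).
Hypothesis lK : listing K c l.
Let n := #|simplices K c|.

Lemma size_listing : size (take n l) = n.
Proof.
case: lK => Ul El; rewrite -(card_uniqP (take_uniq n Ul)).
exact: eq_card.
Qed.

Lemma nth_listing i : (i < n)%N -> nth set0 l i \in simplices K c.
Proof.
move=> ltin; case: lK => _ <-; rewrite -(nth_take set0 ltin) mem_nth //.
by rewrite size_listing.
Qed.

Lemma listing_index s : s \in simplices K c ->
  (index s l < n)%N /\ nth set0 l (index s l) = s.
Proof.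
case: lK => _ El sK; have st : s \in take n l by rewrite El.
split; last by rewrite nth_index // (mem_take st).
by have := index_ltn st; rewrite ltnNge; case: leqP.
Qed.

Lemma index_listing i : (i < n)%N -> index (nth set0 l i) l = i.
Proof.
move=> ltin; apply: index_uniq; last by case: lK.
by apply: leq_trans ltin _; rewrite -size_listing size_take_min geq_minr.
Qed.

Lemma sum_listing (f : {set V} -> R) :
  \sum_(s in simplices K c) f s = \sum_(i < n) f (nth set0 l i).
Proof.
have lP : perm_eq (enum (simplices K c)) (take n l).
  apply: uniq_perm; rewrite ?enum_uniq ?take_uniq //; first by case: lK.
  by move=> s; rewrite mem_enum; case: lK => _ ->.
rewrite -big_enum (perm_big _ lP) /=.
rewrite (big_nth set0) size_listing big_mkord.
by apply: eq_bigr => i _; rewrite nth_take.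
Qed.

End Listing.

Lemma simp_sum_boundary1 K c t (f : {set V} -> R) : t \in simplices K c.+1 ->
  \sum_(s in simp K) boundary1 R t s * f s =
  \sum_(s in simplices K c) boundary1 R t s * f s.
Proof.
move=> tK; rewrite [LHS]big_mkcond [RHS]big_mkcond; apply: eq_bigr => s _.
have [sK|sK] := boolP (s \in simplices K c).
  by move: sK; rewrite inE => /andP[-> _].
by rewrite (boundary1_supp tK sK) mul0r if_same.
Qed.

(** The matrix of the up-Laplacian of [L], with its columns scaled by the weights
    of the q-simplices: the scaling makes it symmetric. *)
Definition gram L c (l : seq {set V}) i k : R :=
  \sum_(t in simplices L c.+1)
     weight L t * (boundary1 R t (nth set0 l i) * boundary1 R t (nth set0 l k)).

(** For y the basis chain of simplex j, divide by the weight of this simplex, take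
    the extension g given by [reduces], and multiply it by the weights again: the
    coboundary of the resulting chain y' has as boundary the image of g under
    the Gram matrix, which is supported in [K]. *)
Lemma up_entry K L c l S i j : simplicial_pair K L ->
  listing K c l -> listing L c l ->
  let n := #|simplices K c| in
  reduces (gram L c l) #|simplices L c| n S -> (i < n)%N -> (j < n)%N ->
  boundary (adjoint L K (pair_chains K L c.+1) (@boundary R d V)
              (cbasis R (nth set0 l j))) (nth set0 l i)
  = S i j / weight K (nth set0 l j).
Proof.
move=> pKL lK lL n redS ltin ltjn; have [sKL wKL] := pKL.
have sKLc : {subset simplices K c <= simplices L c}.
  by move=> s; rewrite !inE => /andP[/(subsetP sKL)-> ->].
have lenN : (n <= #|simplices L c|)%N by apply/subset_leq_card/subsetP.
have wL_neq0 s : s \in simplices L c -> weight L s != 0.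
  by rewrite inE => /andP[sL _]; rewrite gt_eqF // weight_gt0.
(* Coordinates relative to the symmetric matrix are chain values over weights. *)
pose h k := if k == j then (weight L (nth set0 l j))^-1 else 0.
have [g gh Mg] := redS.2 h.
pose y' : chain R V := [ffun s => weight L s * g (index s l)].
have zE a : (a < #|simplices L c|)%N ->
  boundary (coboundary L c.+1 y') (nth set0 l a) = mulv #|simplices L c| (gram L c l) g a.
  move=> ltaN; rewrite boundaryE (bigID (mem (simplices L c.+1))) /= [X in _ + X]big1.
    rewrite addr0 /mulv /gram; under [RHS]eq_bigr do rewrite mulr_suml.
    rewrite exchange_big; apply: eq_bigr => t tL /=.
    rewrite ffunE tL.
    have -> : \sum_(s in simp L) (weight L s)^-1 * (boundary1 R t s * y' s) =
       \sum_(s in simplices L c) boundary1 R t s * (y' s / weight L s).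
      by rewrite -simp_sum_boundary1 //; apply: eq_bigr => s _; rewrite mulrC mulrA.
    rewrite (sum_listing lL) mulr_sumr mulr_suml; apply: eq_bigr => k _.
    rewrite ffunE (index_listing lL) // [weight L _ * g k]mulrC mulfK; first by ring.
    by apply: wL_neq0; apply: nth_listing.
  by move=> t tL; rewrite chains_coboundary // mul0r.
rewrite (@up_adjoint K L c _ y') //.
- have ltiN := leq_trans ltin lenN.
  rewrite zE // Mg // ltin /mulv.
  rewrite (bigD1 (Ordinal ltjn)) //= /h eqxx big1 ?addr0.
    by rewrite wKL //; have := nth_listing lK ltjn; rewrite inE => /andP[].
  by move=> k; rewrite -val_eqE /= => /negPf->; rewrite mulr0.
- move=> s sK; have [ltsn nths] := listing_index lK sK.
  rewrite !ffunE gh // /h -[in RHS]nths.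
  have -> : (nth set0 l (index s l) == nth set0 l j) = (index s l == j).
    apply/eqP/eqP => [eq_nth|->//].
    by rewrite -(index_listing lK ltsn) eq_nth (index_listing lK).
  case: eqP => [<-|_]; last by rewrite mulr0.
  by rewrite nths mulfV // wL_neq0 // sKLc.
move=> s sK; have [sL|sL] := boolP (s \in simplices L c).
  have [ltsN nths] := listing_index lL sL.
  rewrite -nths zE // Mg //; case: ltnP => // ltsn.
  by case/negP: sK; rewrite -nths; apply: nth_listing.
rewrite boundaryE big1 // => t _.
have [tL|tL] := boolP (t \in simplices L c.+1); last by rewrite chains_coboundary // mul0r.
by rewrite (boundary1_supp tL sL) mulr0.
Qed.

Lemma laplacian_mxE q K L l S (i j : 'I_#|simplices K q.+1|) :
  simplicial_pair K L -> listing K q.+1 l -> listing L q.+1 l ->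
  reduces (gram L q.+1 l) #|simplices L q.+1| #|simplices K q.+1| S ->
  laplacian_mx q K L l i j =
  S i j / weight K (nth set0 l j) +
  weight K (nth set0 l i) * \sum_(s in simplices K q)
    boundary1 R (nth set0 l i) s * boundary1 R (nth set0 l j) s / weight K s.
Proof.
move=> pKL lK lL redS; rewrite mxE /laplacian ffunE (up_entry pKL lK lL redS) //.
congr (_ + _); rewrite down_adjoint boundary_cbasis ffunE nth_listing //; congr (_ * _).
under [RHS]eq_bigr do rewrite -mulrA.
rewrite -simp_sum_boundary1 ?nth_listing //.
by apply: eq_bigr => s _; ring.
Qed.

End PersistentLaplacian.

(** * Total correctness with cost for the real RAM *)

Fixpoint loopfree (c : com) : bool :=
  match c with
  | Seq c1 c2 | If _ c1 c2 => loopfree c1 && loopfree c2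
  | While _ _ => false
  | _ => true
  end.

(** The more expensive branch of a conditional counts, so this bounds the cost in
    every state. *)
Fixpoint ccost (c : com) : nat :=
  match c with
  | Skip | While _ _ => 0
  | NSet _ e => (ncost e).+1
  | NPut _ i e => (ncost i + ncost e).+1
  | RSet _ e => (rcost e).+1
  | RPut _ i e => (ncost i + rcost e).+1
  | Seq c1 c2 => (ccost c1 + ccost c2)%N
  | If b c1 c2 => (tcost b + maxn (ccost c1) (ccost c2))%N
  end.

Fixpoint within (X Y Z : seq nat) (c : com) : bool :=
  match c with
  | Skip | RSet _ _ => true
  | NSet x _ => x \in X
  | NPut a _ _ => a \in Y
  | RPut a _ _ => a \in Z
  | Seq c1 c2 | If _ c1 c2 => within X Y Z c1 && within X Y Z c2
  | While _ c1 => within X Y Z c1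
  end.

Definition For x e c :=
  Seq (NSet x (NConst 0))
    (While (NLt (NVar x) e) (Seq c (NSet x (NAdd (NVar x) (NConst 1))))).

Definition seqs (cs : seq com) := foldr Seq Skip cs.

Section Logic.
Variable R : realType.
Implicit Types (st : state R) (c : com).

(** Only meaningful for programs without loops; on these it lets a final state be
    computed by simplification instead of inversion of [exec]. *)
Fixpoint sem c st : state R :=
  match c with
  | Skip | While _ _ => st
  | NSet x e => set_nvar st x (neval st e)
  | NPut a i e => set_narr st a (neval st i) (neval st e)
  | RSet x e => set_rvar st x (reval st e)
  | RPut a i e => set_rarr st a (neval st i) (reval st e)
  | Seq c1 c2 => sem c2 (sem c1 st)
  | If b c1 c2 => if teval st b then sem c1 st else sem c2 st
  end.

Lemma exec_sem c st : loopfree c ->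
  exists2 k, (k <= ccost c)%N & exec c st k (sem c st).
Proof.
elim: c st => [|x e|a i e|x e|a i e|c1 IH1 c2 IH2|b c1 IH1 c2 IH2|//] st /=;
  try by move=> _; eexists; last constructor.
- case/andP=> /(IH1 st)[k1 le1 ex1] /(IH2 (sem c1 st))[k2 le2 ex2].
  by exists (k1 + k2)%N; [apply: leq_add | apply: ExecSeq ex1 ex2].
- case/andP=> /(IH1 st)[k1 le1 ex1] /(IH2 st)[k2 le2 ex2].
  have [tb|fb] := boolP (teval st b).
    exists (tcost b + k1)%N; first by rewrite leq_add2l leq_max le1.
    by apply: ExecIf; rewrite tb.
  exists (tcost b + k2)%N; first by rewrite leq_add2l leq_max le2 orbT.
  by apply: ExecIf; rewrite (negPf fb).
Qed.

(** Arrays outside the footprint are compared as whole functions, so that a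
    statement about their cells carries over by a single rewriting. *)
Definition agree (X Y Z : seq nat) st st' :=
  [/\ forall x, x \notin X -> nvar st' x = nvar st x,
      forall a, a \notin Y -> narr st' a = narr st a
    & forall a, a \notin Z -> rarr st' a = rarr st a].

Lemma agree_refl X Y Z st : agree X Y Z st st.
Proof. by []. Qed.

Lemma agree_trans X Y Z st1 st2 st3 :
  agree X Y Z st1 st2 -> agree X Y Z st2 st3 -> agree X Y Z st1 st3.
Proof.
by case=> n1 a1 r1 [n2 a2 r2]; split=> x xX;
  [rewrite n2 ?n1 | rewrite a2 ?a1 | rewrite r2 ?r1].
Qed.

Lemma agree_sub X Y Z X' Y' Z' st st' :
  {subset X <= X'} -> {subset Y <= Y'} -> {subset Z <= Z'} ->
  agree X Y Z st st' -> agree X' Y' Z' st st'.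
Proof.
by move=> sX sY sZ [n a r]; split=> x; [move/(contra (sX x))/n
  | move/(contra (sY x))/a | move/(contra (sZ x))/r].
Qed.

Lemma agree_set_nvar X Y Z st x v : x \in X -> agree X Y Z st (set_nvar st x v).
Proof.
by move=> xX; split=> //= y yX; rewrite /upd; case: eqP => // yx; rewrite yx xX in yX.
Qed.

Lemma agree_set_narr X Y Z st a i v : a \in Y -> agree X Y Z st (set_narr st a i v).
Proof.
by move=> aY; split=> //= b bY; rewrite /upd; case: eqP => // ba; rewrite ba aY in bY.
Qed.

Lemma agree_set_rarr X Y Z st a i v : a \in Z -> agree X Y Z st (set_rarr st a i v).
Proof.
by move=> aZ; split=> //= b bZ; rewrite /upd; case: eqP => // ba; rewrite ba aZ in bZ.
Qed.

Lemma exec_agree X Y Z c st k st' :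
  exec c st k st' -> within X Y Z c -> agree X Y Z st st'.
Proof.
elim=> {c st k st'} //=.
- by move=> st x e; apply: agree_set_nvar.
- by move=> st a i e; apply: agree_set_narr.
- by move=> st a i e; apply: agree_set_rarr.
- move=> st st1 st2 c1 c2 _ _ _ IH1 _ IH2 /andP[/IH1 ag1 /IH2].
  exact: agree_trans.
- by move=> st st1 b c1 c2 _ _ IH /andP[w1 w2]; apply: IH; case: ifP.
- move=> st st1 st2 b c _ _ _ _ IH1 _ IH2 w; apply: agree_trans (IH2 w).
  exact: IH1.
Qed.

Lemma sem_agree X Y Z c st : loopfree c -> within X Y Z c ->
  agree X Y Z st (sem c st).
Proof. by case/(exec_sem st) => k _; apply: exec_agree. Qed.

(** Total correctness: the semantics being deterministic, the existence of one
    terminating run within the bound says all there is to say. *)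
Definition runs c st (B : nat) (Q : state R -> Prop) :=
  exists k st', [/\ exec c st k st', (k <= B)%N & Q st'].

Lemma runs_le c st B B' Q : runs c st B Q -> (B <= B')%N -> runs c st B' Q.
Proof.
by case=> k [st' [ex le_k Qst']] leB; exists k, st'; split=> //; apply: leq_trans leB.
Qed.

Lemma runs_imp c st B (Q Q' : state R -> Prop) :
  runs c st B Q -> (forall st', Q st' -> Q' st') -> runs c st B Q'.
Proof.
by case=> k [st' [ex le_k Qst']] sQ; exists k, st'; split=> //; apply: sQ.
Qed.

Lemma runs_agree X Y Z c st B Q : within X Y Z c -> runs c st B Q ->
  runs c st B (fun st' => agree X Y Z st st' /\ Q st').
Proof.
move=> w [k [st' [ex le_k Qst']]]; exists k, st'; split=> //; split=> //.
exact: exec_agree ex w.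
Qed.

Lemma runs_sem c st B (Q : state R -> Prop) : loopfree c -> (ccost c <= B)%N ->
  Q (sem c st) -> runs c st B Q.
Proof.
move=> lf leB Qc; have [k le_k ex] := exec_sem st lf.
by exists k, (sem c st); split=> //; apply: leq_trans leB.
Qed.

Lemma runs_seq c1 c2 st B1 B2 Q1 Q : runs c1 st B1 Q1 ->
  (forall st1, Q1 st1 -> runs c2 st1 B2 Q) -> runs (Seq c1 c2) st (B1 + B2) Q.
Proof.
case=> k1 [st1 [ex1 le1 /[swap] /[apply]]] [k2 [st2 [ex2 le2 Qst2]]].
by exists (k1 + k2)%N, st2; split=> //; [apply: ExecSeq ex1 ex2 | apply: leq_add].
Qed.

Lemma runs_if b c1 c2 st B Q :
  runs (if teval st b then c1 else c2) st B Q ->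
  runs (If b c1 c2) st (tcost b + B) Q.
Proof.
case=> k [st' [ex le_k Qst']]; exists (tcost b + k)%N, st'.
by split=> //; [apply: ExecIf | rewrite leq_add2l].
Qed.

(** The invariant is about the state between two iterations and may not mention
    the loop variable; in exchange the body is given for free that everything
    outside the syntactic footprint of the loop is as it was at the start. *)
Lemma runs_for X Y Z x e c n B (I : nat -> state R -> Prop) st :
  within X Y Z c -> x \notin X ->
  (forall st', agree (x :: X) Y Z st st' -> neval st' e = n) ->
  (forall i st' v, I i st' -> I i (set_nvar st' x v)) ->
  I 0 st ->
  (forall i st', (i < n)%N -> agree (x :: X) Y Z st st' -> nvar st' x = i ->
     I i st' -> runs c st' B (I i.+1)) ->
  runs (For x e c) st (n.+1 * (B + ncost e + 6))
    (fun st' => agree (x :: X) Y Z st st' /\ I n st').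
Proof.
move=> w xX en Ix I0 Istep; rewrite /For.
apply: runs_le (_ : (2 + (n * (B + ncost e + 6) + (ncost e + 2)) <= _)%N); last first.
  by rewrite mulSn; lia.
apply: (@runs_seq _ _ _ _ _ (fun st1 =>
  [/\ agree (x :: X) Y Z st st1, nvar st1 x = 0 & I 0 st1])).
  apply: runs_sem => //=; split; last exact: Ix.
    by apply: agree_set_nvar; rewrite mem_head.
  by rewrite /upd eqxx.
(* Induction on the number r of remaining iterations. *)
suff loop r : forall i st1, (i + r = n)%N -> agree (x :: X) Y Z st st1 ->
  nvar st1 x = i -> I i st1 ->
  runs (While (NLt (NVar x) e) (Seq c (NSet x (NAdd (NVar x) (NConst 1))))) st1
    (r * (B + ncost e + 6) + (ncost e + 2))
    (fun st' => agree (x :: X) Y Z st st' /\ I n st').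
  by move=> st1 [ag x0 I1]; apply: (loop n 0%N).
elim: r => [|r IH] i st1.
  rewrite addn0 => -> ag xn In; exists (tcost (NLt (NVar x) e)), st1.
  split=> //=; last by lia.
  by apply: ExecWhileStop; rewrite /= xn (en _ ag) ltnn.
move=> ir ag xi Ii.
have [k1 [st2 [ex1 le1 [ag2 I2]]]] : runs c st1 B (fun st' => agree X Y Z st1 st' /\ I i.+1 st').
  by apply: runs_agree => //; apply: Istep => //; lia.
pose st3 := set_nvar st2 x i.+1.
have x2 : nvar st2 x = i by case: ag2 => ->.
have ex3 : exec (NSet x (NAdd (NVar x) (NConst 1))) st2 4 st3.
  by have := ExecNSet st2 x (NAdd (NVar x) (NConst 1)); rewrite [neval _ _]/= x2 addn1.
have ag3 : agree (x :: X) Y Z st st3.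
  apply: agree_trans ag _; apply: agree_trans (agree_sub _ _ _ ag2) _ => //.
    by move=> y yX; rewrite inE yX orbT.
  by apply: agree_set_nvar; rewrite mem_head.
have [k4 [st4 [ex4 le4 Q4]]] := IH i.+1 st3 ltac:(lia) ag3 ltac:(by rewrite /= /upd eqxx) (Ix _ _ _ I2).
exists (tcost (NLt (NVar x) e) + (k1 + 4) + k4)%N, st4; split=> //.
  apply: ExecWhileStep (ExecSeq ex1 ex3) ex4.
  by rewrite /= xi (en _ ag); lia.
by rewrite /=; lia.
Qed.

Section Unroll.
Variables (T : eqType) (body : T -> com).
Implicit Type s : seq T.

Lemma loopfree_seqs s : (forall p, loopfree (body p)) -> loopfree (seqs (map body s)).
Proof. by move=> lf; elim: s => //= p s ->; rewrite lf. Qed.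

Lemma within_seqs X Y Z s : (forall p, within X Y Z (body p)) ->
  within X Y Z (seqs (map body s)).
Proof. by move=> lf; elim: s => //= p s ->; rewrite lf. Qed.

(** The invariant is indexed by the part of the list already treated; for the
    unrolled loops below it says that a cell holds a sum over this part. *)
Lemma sem_seqs (I : seq T -> state R -> Prop) s st : I [::] st ->
  (forall s' p st', p \in s -> I s' st' -> I (rcons s' p) (sem (body p) st')) ->
  I s (sem (seqs (map body s)) st).
Proof.
move=> I0 Istep; rewrite -[s in I s]/([::] ++ s).
elim: s [::] st I0 Istep => [|p s IH] s0 st I0 Istep /=; first by rewrite cats0.
rewrite -cat_rcons; apply: IH => [|s' p' st' p's]; apply: Istep => //.
  by rewrite mem_head.
by rewrite inE p's orbT.
Qed.

End Unroll.

End Logic.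

(** * The programs *)

(** Variables: [vm], [vt] the number of complexes and the current t; [vW] the row
    length of all stored matrices; [vA], [vD] the current output address and its
    decrement from s to s - 1; [vn], [vs] the current size and time; [vE] the
    size of an output block; the others are loop counters.  Arrays: [tab] (of
    naturals) the multiples of [vW]; [work] (of reals) the successive Schur
    complements; [out] the output. *)
Local Notation vm := 0%N (only parsing).
Local Notation vt := 1%N (only parsing).
Local Notation vW := 2%N (only parsing).
Local Notation vD := 3%N (only parsing).
Local Notation vA := 4%N (only parsing).
Local Notation vn := 5%N (only parsing).
Local Notation vs := 6%N (only parsing).
Local Notation vi := 7%N (only parsing).
Local Notation vj := 8%N (only parsing).
Local Notation vr := 9%N (only parsing).
Local Notation vc := 10%N (only parsing).
Local Notation vl := 11%N (only parsing).
Local Notation vE := 12%N (only parsing).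
Local Notation tab := 6%N (only parsing).
Local Notation work := 7%N (only parsing).
Local Notation out := 6%N (only parsing).

(** Cells have addresses such as j * k + l, and the machine cannot multiply; as [k]
    is fixed by the dimension, the product is an expression of constant size. *)
Fixpoint nscale (k : nat) (e : nexp) : nexp :=
  if k is k'.+1 then NAdd (nscale k' e) e else NConst 0.

Definition entry k x l := NAdd (nscale k (NVar x)) (NConst l).

Definition pairs k := [seq (l, l') | l <- iota 0 k, l' <- iota 0 k].

Definition at_cell x y := NAdd (NGet tab (NVar x)) (NVar y).

Definition fill_body a base pre e :=
  Seq pre (RPut a (NAdd (NAdd base (NGet tab (NVar vi))) (NVar vj)) e).

Definition fill a base pre e :=
  For vi (NVar vn) (For vj (NVar vn) (fill_body a base pre e)).

(** Products of two run-time numbers are not available in constant time.  The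
    multiples of the row length are therefore tabulated, in linear time. *)
Definition table :=
  Seq (NPut tab (NConst 0) (NConst 0))
    (For vi (NVar vn)
      (NPut tab (NAdd (NVar vi) (NConst 1)) (NAdd (NGet tab (NVar vi)) (NVar vW)))).

(** One product of two stored coefficients of column j.  The guards are necessary:
    a column of a simplex of K_t may store cancelling coefficients at rows
    outside K_t, for which no cell is reserved. *)
Definition up_body k (x : nat * nat) :=
  let row l := NGet 5 (entry k vj l) in
  let cell := NAdd (NGet tab (row x.1)) (row x.2) in
  If (NLt (row x.1) (NVar vn))
    (If (NLt (row x.2) (NVar vn))
      (RPut work cell (RAdd (RGet work cell)
         (RMul (RGet 2 (NVar vj))
           (RMul (RGet 5 (entry k vj x.1)) (RGet 5 (entry k vj x.2))))))
      Skip)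
    Skip.

Definition up k := For vj (NGet 2 (NVar vt)) (seqs (map (up_body k) (pairs k))).

(** [vn] holds the new size, which is also the index of the eliminated row; the
    cells of that row and column lie outside the block being rewritten, so the
    update can be made in place. *)
Definition pivot_exp :=
  RSub (RGet work (at_cell vi vj))
    (RDiv (RMul (RGet work (at_cell vi vn)) (RGet work (at_cell vn vj)))
          (RGet work (at_cell vn vn))).

Definition pivot := fill work (NConst 0) Skip pivot_exp.

(** Summing over pairs of stored coefficients whose rows coincide yields the
    weighted inner product of two columns without searching for common faces. *)
Definition down_body k (x : nat * nat) :=
  let row := NGet 4 (entry k vi x.1) in
  If (NEq row (NGet 4 (entry k vj x.2)))
    (RSet 0 (RAdd (RVar 0)
      (RDiv (RMul (RGet 4 (entry k vi x.1)) (RGet 4 (entry k vj x.2))) (RGet 0 row))))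
    Skip.

Definition down k := Seq (RSet 0 (RConst 0)) (seqs (map (down_body k) (pairs k))).

Definition emit_exp :=
  RAdd (RDiv (RGet work (at_cell vi vj)) (RGet 1 (NVar vj)))
       (RMul (RGet 1 (NVar vi)) (RVar 0)).

Definition emit k := fill out (NVar vA) (down k) emit_exp.

Definition stage k :=
  Seq (If (NLt (NGet 1 (NVar vs)) (NVar vn))
         (Seq (NSet vn (NGet 1 (NVar vs))) pivot) Skip)
    (Seq (emit k)
      (Seq (NSet vA (NSub (NVar vA) (NVar vD))) (NSet vs (NSub (NVar vs) (NConst 1))))).

(** [k1] and [k2] are the numbers of stored coefficients per column of the boundary
    matrices in dimensions q and q + 1. *)
Definition sweep k1 k2 :=
  Seq (NSet vn (NGet 1 (NVar vt)))
    (Seq table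
      (Seq (fill work (NConst 0) Skip (RConst 0))
        (Seq (up k2)
          (Seq (NSet vs (NVar vt)) (For vr (NVar vt) (stage k1)))))).

Definition sweep_vars := [:: vA; vn; vs; vi; vj; vr].

(** The address [x] belongs to an entry, of the n x n block stored at [b] with row
    length [W], that precedes position (i, j) in row-major order. *)
Definition filled b W n i j x :=
  [&& b <= x, (x - b) %% W < n
    & ((x - b) %/ W < i) || ((x - b) %/ W == i) && ((x - b) %% W < j)]%N.

Lemma cell_divn b W i j : (j < W)%N -> ((b + i * W + j - b) %/ W)%N = i.
Proof. by move=> ltjW; rewrite -addnA addKn divnMDl ?divn_small ?addn0 //; lia. Qed.

Lemma cell_modn b W i j : (j < W)%N -> ((b + i * W + j - b) %% W)%N = j.
Proof. by move=> ltjW; rewrite -addnA addKn modnMDl modn_small. Qed.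

Lemma filled_cell b W n i0 j0 i j : (j < W)%N ->
  filled b W n i0 j0 (b + i * W + j) = (j < n)%N && ((i < i0) || (i == i0) && (j < j0))%N.
Proof. by move=> ltjW; rewrite /filled cell_divn // cell_modn // -addnA leq_addr. Qed.

Lemma filled_step b W n i j x : (j < n <= W)%N ->
  filled b W n i j.+1 x = filled b W n i j x || (x == b + i * W + j)%N.
Proof.
move=> ltjn; have ltjW : (j < W)%N by lia.
case: (eqVneq x _) => [->|neq]; first by rewrite orbT filled_cell //; lia.
rewrite orbF /filled; case: (leqP b x) => //= lebx; congr (_ && (_ || _)).
case: eqVneq => //= divi; rewrite ltnS leq_eqVlt; case: eqVneq => //= modj.
by case/eqP: neq; rewrite -{1}(subnKC lebx) {1}(divn_eq (x - b) W) divi modj addnA.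
Qed.

Lemma filled_row b W n i x : filled b W n i n x = filled b W n i.+1 0 x.
Proof.
rewrite /filled; case: (leqP b x) => //= _; case: (ltnP (_ %% W)) => //= _.
by rewrite ltn0 andbT andbF orbF ltnS [RHS]leq_eqVlt orbC.
Qed.

Lemma filled_range b W n i x : (n <= W)%N -> (i <= W)%N ->
  filled b W n i 0 x -> (b <= x < b + W * W)%N.
Proof.
move=> lenW leiW /and3P[lebx modx]; rewrite andbF orbF => divx; rewrite lebx /=.
have ltW := ltn_mod (x - b) W; have := divn_eq (x - b) W.
set y := (x - b)%N in modx divx ltW *; have -> : x = (b + y)%N by rewrite /y; lia.
move=> ->; rewrite ltn_add2l; nia.
Qed.

Section Runs.
Variable R : realType.
Implicit Types st : state R.

Lemma nscaleE st k e : neval st (nscale k e) = (neval st e * k)%N.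
Proof. by elim: k => [|k IH] /=; rewrite ?muln0 // IH mulnS addnC. Qed.

Lemma within_sub X Y Z X' Y' Z' c : {subset X <= X'} -> {subset Y <= Y'} ->
  {subset Z <= Z'} -> within X Y Z c -> within X' Y' Z' c.
Proof.
move=> sX sY sZ; elim: c => //= [x _|a _ _|a _ _|c1 IH1 c2 IH2|_ c1 IH1 c2 IH2].
- exact: sX.
- exact: sY.
- exact: sZ.
- by case/andP=> /IH1-> /IH2.
- by case/andP=> /IH1-> /IH2.
Qed.

Definition fill_cost a base pre e n :=
  (n.+1 * (n.+1 * (ccost (fill_body a base pre e) + 1 + 6) + 1 + 6))%N.

(** The value of an entry may depend on the array being rewritten as long as it
    only uses cells not yet overwritten: this is what the last hypothesis
    provides for the pivot step. *)
Lemma runs_fill a base pre e st n W b (g : nat -> nat -> R) :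
  loopfree pre -> within [::] [::] [::] pre ->
  nvar st vn = n -> (n <= W)%N -> (forall i, (i < n)%N -> narr st tab i = i * W)%N ->
  (forall st', agree [:: vi; vj] [::] [:: a] st st' -> neval st' base = b) ->
  (forall i j st', (i < n)%N -> (j < n)%N ->
     agree [:: vi; vj] [::] [:: a] st st' -> nvar st' vi = i -> nvar st' vj = j ->
     (forall x, ~~ filled b W n i j x -> rarr st' a x = rarr st a x) ->
     reval (sem pre st') e = g i j) ->
  runs (fill a base pre e) st (fill_cost a base pre e n)
    (fun st' => agree [:: vi; vj] [::] [:: a] st st' /\
       forall x, rarr st' a x = if filled b W n n 0 x
                                then g ((x - b) %/ W)%N ((x - b) %% W)%N
                                else rarr st a x).
Proof.
move=> lf w en lenW tabE baseE valE.
pose F i j x := if filled b W n i j x then g ((x - b) %/ W)%N ((x - b) %% W)%N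
                else rarr st a x.
have wbody X : within X [::] [:: a] (fill_body a base pre e).
  by rewrite /= mem_head andbT; apply: within_sub w.
have lfbody : loopfree (fill_body a base pre e) by rewrite /= lf.
rewrite /fill /fill_cost.
apply: (@runs_for R [:: vj] [::] [:: a] vi _ _ n _ (fun i st' => forall x, rarr st' a x = F i 0%N x)).
- by have /= -> := wbody [:: vj].
- by [].
- by move=> st' [n1 _ _]; rewrite /= n1.
- by [].
- by move=> x; rewrite /F /filled /= andbF /= andbF andbF.
move=> i st1 ltin ag1 i1 F1.
apply: runs_imp (_ : runs _ _ _ (fun st' => agree [:: vj] [::] [:: a] st1 st' /\
   (forall x, rarr st' a x = F i n x))) _; last first.
  by move=> st2 [_ F2] x; rewrite F2 /F filled_row.
apply: (@runs_for R [::] [::] [:: a] vj _ _ n _ (fun j st' => forall x, rarr st' a x = F i j x)) => //.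
  move=> st' [n1 _ _]; rewrite /= n1 //.
  by case: ag1 => /= -> //.
move=> j st2 ltjn ag2 j2 F2; apply: runs_sem => //.
have ag2' : agree [:: vi; vj] [::] [:: a] st st2.
  apply: agree_trans ag1 _; apply: agree_sub ag2 => // y.
  by rewrite !inE orbF => /eqP ->; rewrite orbT.
have i2 : nvar st2 vi = i by case: ag2 => ->.
have [np ap rp] := sem_agree st2 lf w.
have agp : agree [:: vi; vj] [::] [:: a] st (sem pre st2).
  apply: agree_trans ag2' _; split=> x _; [exact: np | exact: ap | exact: rp].
have vali : reval (sem pre st2) e = g i j.
  by apply: valE => // x nfx; rewrite F2 /F (negPf nfx).
move=> x; rewrite /= /upd eqxx vali (baseE _ agp) !np // ap // j2 i2.
have -> : narr st2 tab i = (i * W)%N by case: ag2' => _ -> // _; apply: tabE.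
rewrite /F filled_step ?ltjn //; case: eqVneq => [->|_].
  by rewrite orbT cell_divn ?cell_modn //; lia.
by rewrite orbF rp // F2.
Qed.

End Runs.

(** * Correctness of a sweep *)

Section Sweep.
Variables (R : realType) (k1 k2 : nat) (st0 : state R).
Implicit Types st : state R.

Let t := nvar st0 vt.
Let W := nvar st0 vW.
Let D := nvar st0 vD.
Let cnt := narr st0 1.
Let N := cnt t.
Let p := narr st0 2 t.

Definition up_term j (x : nat * nat) a b : R :=
  if (narr st0 5 (j * k2 + x.1) == a) && (narr st0 5 (j * k2 + x.2) == b)
  then rarr st0 2 j * (rarr st0 5 (j * k2 + x.1)%N * rarr st0 5 (j * k2 + x.2)%N)
  else 0.

Definition up_mx a b : R := \sum_(j < p) \sum_(x <- pairs k2) up_term j x a b.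

Definition down_term i j (x : nat * nat) : R :=
  if (narr st0 4 (i * k1 + x.1) == narr st0 4 (j * k1 + x.2))%N
  then rarr st0 4 (i * k1 + x.1)%N * rarr st0 4 (j * k1 + x.2)%N
       / rarr st0 0 (narr st0 4 (i * k1 + x.1)%N)
  else 0.

Definition down_mx i j : R := \sum_(x <- pairs k1) down_term i j x.

Definition touched := agree sweep_vars [:: tab] [:: out; work] st0.

Hypothesis leNW : (N <= W)%N.
Hypothesis leWD : (W * W <= D)%N.
Hypothesis cnt_step : forall s, (0 < s < t)%N -> (cnt s <= cnt s.+1 <= (cnt s).+1)%N.
Hypothesis sym_up : msym N up_mx.
Hypothesis iso_up : null_isotropic N up_mx.

Lemma cnt_le s : (0 < s <= t)%N -> (cnt s <= N)%N.
Proof.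
move=> sP; rewrite /N -(subnKC (proj2 (andP sP))).
have: (s + (t - s) <= t)%N by lia.
elim: (t - s)%N => [|r IH] le_t; first by rewrite addn0.
rewrite addnS; apply: leq_trans (IH _) _; first by lia.
by have /andP[] : (cnt (s + r) <= cnt (s + r).+1 <= (cnt (s + r)).+1)%N by apply: cnt_step; lia.
Qed.

Lemma touched_trans X Y Z st st' : touched st -> agree X Y Z st st' ->
  subseq X sweep_vars -> subseq Y [:: tab] -> subseq Z [:: out; work] -> touched st'.
Proof.
move=> tst ag sX sY sZ; apply: agree_trans tst _; apply: agree_sub ag => x;
  exact: mem_subseq.
Qed.

Lemma runs_table st : touched st -> nvar st vn = N ->
  runs table st (5 + N.+1 * 20) (fun st' => [/\ touched st', nvar st' vn = N
    & forall i, (i <= N)%N -> narr st' tab i = (i * W)%N]).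
Proof.
move=> tst en; pose I i st' := forall i', (i' <= i)%N -> narr st' tab i' = (i' * W)%N.
apply: (@runs_seq _ _ _ _ _ _ (fun st1 => agree [::] [:: tab] [::] st st1 /\ narr st1 tab 0 = 0%N)).
  by apply: runs_sem => //; split; first exact: agree_set_narr.
move=> st1 [ag1 tab0]; have [n1 a1 r1] := ag1.
apply: runs_le (_ : runs _ _ (N.+1 * (13 + 1 + 6)) _) (leqnn _).
apply: runs_imp (@runs_for R [::] [:: tab] [::] vi _ _ N _ I st1 _ _ _ _ _ _) _ => //.
- by move=> st2 [n2 _ _]; rewrite /= n2 // n1.
- by move=> i'; rewrite leqn0 => /eqP->.
- move=> i st2 ltiN [n2 a2 r2] i2 I2; apply: runs_sem => // i'.
  rewrite /= /upd eqxx i2 addn1 n2 // n1 // leq_eqVlt I2 //.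
  case: eqVneq => [-> _|_ /=]; last exact: I2.
  have [tn _ _] := tst; by rewrite tn // -/W mulSn addnC.
move=> st2 [ag2 IN]; have tst1 := touched_trans tst ag1 isT isT isT.
split=> //; first exact: touched_trans tst1 ag2 isT isT isT.
by case: ag2 => -> // _ _; rewrite n1.
Qed.

(** What all phases of a sweep share: the input is intact, the current size is [n]
    and the multiples of the row length are available. *)
Definition ready n st := [/\ touched st, nvar st vn = n
    & forall i, (i <= N)%N -> narr st tab i = (i * W)%N].

(** The matrix in working memory is only prescribed on the current block; the
    leftovers of eliminated rows are arbitrary. *)
Definition cells n st (S : nat -> nat -> R) :=
  forall i j, (i < n)%N -> (j < n)%N -> rarr st work (i * W + j)%N = S i j.

Lemma ready_trans n st st' a : ready n st -> agree [:: vi; vj] [::] [:: a] st st' ->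
  subseq [:: a] [:: out; work] -> ready n st'.
Proof.
move=> [tst en et] ag sa; split; first exact: touched_trans tst ag isT isT sa.
  by case: ag => ->.
by move=> i leiN; case: ag => _ -> // _; apply: et.
Qed.

Lemma cells_fill n st st' g : (n <= W)%N ->
  (forall x, rarr st' work x = if filled 0 W n n 0 x then g ((x - 0) %/ W)%N ((x - 0) %% W)%N
                               else rarr st work x) ->
  cells n st' g.
Proof.
move=> lenW fl i j ltin ltjn; have ltjW := leq_trans ltjn lenW.
rewrite -[(i * W)%N]add0n fl filled_cell // ltin ltjn /=.
by rewrite cell_divn // cell_modn.
Qed.

Lemma runs_zero st : ready N st ->
  runs (fill work (NConst 0) Skip (RConst 0)) st
    (fill_cost work (NConst 0) Skip (RConst 0) N)
    (fun st' => ready N st' /\ cells N st' (fun _ _ => 0)).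
Proof.
move=> rst; have [tst en et] := rst.
apply: runs_imp (@runs_fill R work (NConst 0) Skip (RConst 0) st N W 0 (fun _ _ => 0)
  isT isT en leNW _ _ _) _ => //.
  by move=> i ltiN; apply: et; apply: ltnW.
move=> st' [ag fl]; split; first exact: ready_trans rst ag isT.
exact: cells_fill fl.
Qed.

Definition up_cost := (ccost (seqs (map (up_body k2) (pairs k2))) + 2 + 6)%N.

Lemma runs_up st : ready N st -> cells N st (fun _ _ => 0) ->
  runs (up k2) st (p.+1 * up_cost) (fun st' => ready N st' /\ cells N st' up_mx).
Proof.
move=> rst c0; have [tst en et] := rst.
have lf : loopfree (seqs (map (up_body k2) (pairs k2))) by apply: loopfree_seqs.
have w : within [::] [::] [:: work] (seqs (map (up_body k2) (pairs k2))).
  by apply: within_seqs.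
pose I j st' := cells N st' (fun a b => \sum_(j' < j) \sum_(x <- pairs k2) up_term j' x a b).
apply: runs_imp (@runs_for R [::] [::] [:: work] vj (NGet 2 (NVar vt)) _ p _ I st w _ _ _ _ _) _ => //.
- move=> st' ag; have [n1 a1 _] := touched_trans tst ag isT isT isT.
  by rewrite /= n1 // a1.
- by move=> a b lta ltb; rewrite big_ord0 c0.
- move=> j st1 ltjp ag1 j1 I1; apply: runs_sem => //.
  have [tn ta tr] := touched_trans tst ag1 isT isT isT.
  have n1 : nvar st1 vn = N by case: ag1 => ->.
  have et1 i : (i < N)%N -> narr st1 tab i = (i * W)%N.
    by case: ag1 => _ -> // _ /ltnW; apply: et.
  pose J s st' := agree [::] [::] [:: work] st1 st' /\ cells N st' (fun a b =>
     \sum_(j' < j) \sum_(x <- pairs k2) up_term j' x a b + \sum_(x <- s) up_term j x a b).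
  have J0 : J [::] st1.
    by split=> // a b lta ltb; rewrite big_nil addr0 I1.
  have : J (pairs k2) (sem (seqs (map (up_body k2) (pairs k2))) st1).
    apply: sem_seqs => // s x st2 xk [ag2 J2]; split.
      by apply: agree_trans ag2 _; apply: sem_agree.
    have [n2 a2 r2] := ag2.
    move=> a b lta ltb; rewrite big_rcons /= addrA.
    have ltbW := leq_trans ltb leNW.
    rewrite /=.
    rewrite !nscaleE /= !n2 // !a2 // (r2 2%N) // (r2 5%N) // j1 n1.
    rewrite (ta 5%N) // (tr 2%N) // (tr 5%N) // /up_term.
    set r := narr st0 5 (j * k2 + x.1)%N; set r' := narr st0 5 (j * k2 + x.2)%N.
    case: (ltnP r N) => [ltrN|leNr]; last first.
      by rewrite gtn_eqF ?(leq_trans lta) //= addr0 J2.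
    case: (ltnP r' N) => [ltr'N|leNr']; last first.
      by rewrite [r' == b]gtn_eqF ?(leq_trans ltb) // andbF addr0 J2.
    rewrite /= /upd eqxx -/r -/r' et1 //.
    have ltr'W := leq_trans ltr'N leNW.
    (* Rows of length W >= N make the address determine the entry. *)
    have -> : (a * W + b == r * W + r')%N = (r == a) && (r' == b).
      apply/eqP/andP => [eqc|[/eqP-> /eqP->]//].
      have := cell_divn 0 a ltbW; have := cell_modn 0 a ltbW.
      by rewrite !add0n eqc -[(r * W)%N]add0n cell_divn // cell_modn // => -> ->.
    case: andP => [[/eqP ra /eqP rb]|_]; last by rewrite addr0 J2.
    by rewrite J2 // ra rb.
  case=> _ Jk a b lta ltb; rewrite Jk // big_ord_recr //.
move=> st' [ag Ip]; split; last exact: Ip.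
split; first exact: touched_trans tst ag isT isT isT.
  by case: ag => ->.
by move=> i leiN; case: ag => _ -> // _; apply: et.
Qed.

Lemma runs_pivot st n S : (n < N)%N -> ready n st -> cells n.+1 st S ->
  runs pivot st (fill_cost work (NConst 0) Skip pivot_exp n)
    (fun st' => [/\ agree [:: vi; vj] [::] [:: work] st st', ready n st'
       & cells n st' (schur n S)]).
Proof.
move=> ltnN rst cS; have [tst en et] := rst.
have ltnW' := leq_trans ltnN leNW.
apply: runs_imp (@runs_fill R work (NConst 0) Skip _ st n W 0 (schur n S)
  isT isT en (ltnW ltnW') _ _ _) _ => //.
- by move=> i ltin; apply: et; lia.
- move=> i j st1 ltin ltjn ag1 i1 j1 unf; have [n1 a1 _] := ag1.
  rewrite /= i1 j1 n1 // en a1 // !et 1?ltnW //; last by lia.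
  (* Row n and column n are outside the block, and (i, j) comes last. *)
  have cellE a b : (b <= n)%N -> ~~ [&& b < n & (a < i) || (a == i) && (b < j)]%N ->
     rarr st1 work (a * W + b)%N = rarr st work (a * W + b)%N.
    by move=> lebn nf; apply: unf; rewrite -[(a * W)%N]add0n filled_cell //; lia.
  rewrite !cellE ?ltnn ?(ltnW ltjn) //; try lia.
  by rewrite !cS // /schur; lia.
by move=> st' [ag fl]; split; [|exact: ready_trans rst ag isT | apply: cells_fill fl; lia].
Qed.

Definition entry_mx S i j :=
  S i j / rarr st0 1 j + rarr st0 1 i * down_mx i j.

Lemma runs_emit st n S : (n <= N)%N -> ready n st -> cells n st S ->
  runs (emit k1) st (fill_cost out (NVar vA) (down k1) emit_exp n)
    (fun st' => [/\ agree [:: vi; vj] [::] [:: out] st st', ready n st',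
       cells n st' S
     & forall x, rarr st' out x = if filled (nvar st vA) W n n 0 x
         then entry_mx S ((x - nvar st vA) %/ W)%N ((x - nvar st vA) %% W)%N
         else rarr st out x]).
Proof.
move=> lenN rst cS; have [tst en et] := rst.
have lf : loopfree (seqs (map (down_body k1) (pairs k1))) by apply: loopfree_seqs.
have w : within [::] [::] [::] (seqs (map (down_body k1) (pairs k1))).
  by apply: within_seqs.
apply: runs_imp (@runs_fill R out (NVar vA) (down k1) _ st n W (nvar st vA) (entry_mx S)
  _ _ en (leq_trans lenN leNW) _ _ _) _ => //.
- by move=> i ltin; apply: et; lia.
- by move=> st' [n1 _ _]; rewrite /= n1.
- move=> i j st1 ltin ltjn ag1 i1 j1 _.
  have [tn ta tr] : touched st1 by apply: touched_trans tst ag1 isT isT isT.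
  have [n1 a1 r1] := ag1.
  set st2 := sem _ st1.
  have [ag2 r0] : agree [::] [::] [::] st1 st2 /\ rvar st2 0 = down_mx i j.
    rewrite /st2 /=; set st3 := set_rvar _ _ _.
    pose J s st' := agree [::] [::] [::] st1 st' /\ rvar st' 0 = \sum_(x <- s) down_term i j x.
    apply: (@sem_seqs R _ (down_body k1) J); first by rewrite /J big_nil; split.
    move=> s x st4 _ [ag4 J4]; split; first by apply: agree_trans ag4 _; apply: sem_agree.
    have [n4 a4 r4] := ag4.
    rewrite /= !nscaleE /= !n4 // !a4 // !r4 // i1 j1 ta // (tr 0%N) // (tr 4%N) // big_rcons /= /down_term.
    case: eqP => _; by rewrite /= ?addr0 // /upd eqxx J4.
  have [n2 a2 r2] := ag2.
  rewrite /= r0 !n2 // !a2 // !r2 // i1 j1 a1 // et; last by lia.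
  by rewrite r1 // cS // !tr.
move=> st' [ag fl]; split=> //; first exact: ready_trans rst ag isT.
by move=> i j ltin ltjn; case: ag => _ _ -> //; apply: cS.
Qed.

Variable B0 : nat.
Hypothesis vA0 : nvar st0 vA = (B0 + t * D)%N.

(** Each stage owns an interval of output addresses of length W^2; these intervals
    are disjoint because the distance D of their origins is at least W^2. *)
Definition block s x := (B0 + s * D <= x < B0 + s * D + W * W)%N.

Definition written s st := exists2 S, reduces up_mx N (cnt s) S &
  forall i j, (i < cnt s)%N -> (j < cnt s)%N ->
    rarr st out (B0 + s * D + i * W + j)%N = entry_mx S i j.

(** The second part, that the rest of the output is unchanged, is what allows
    several sweeps to share the output array. *)
Definition swept r st :=
  (forall s, (t - r < s <= t)%N -> written s st) /\
  (forall x, (forall s, (t - r < s <= t)%N -> ~~ block s x) ->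
     rarr st out x = rarr st0 out x).

(** Before stage [r] the size [n] is still the one for s + 1, where s = t - r is
    treated next; so it exceeds the number of simplices for s by at most one.
    The output address is only meaningful while stages remain. *)
Definition stage_inv r st := exists n S,
  [/\ (n <= N)%N /\ ((r < t)%N -> (cnt (t - r) <= n <= (cnt (t - r)).+1)%N),
      ready n st, cells n st S /\ reduces up_mx N n S,
      nvar st vs = (t - r)%N /\ ((r <= t)%N -> nvar st vA = (B0 + (t - r) * D)%N)
    & swept r st].

Definition fill_rate a base pre e := (ccost (fill_body a base pre e) + 14)%N.

(** The sizes vary during a sweep; the bound in terms of the initial size makes
    the cost of all the stages uniform. *)
Lemma fill_cost_rate a base pre e n n' : (n <= n')%N ->
  (fill_cost a base pre e n <= fill_rate a base pre e * n'.+1 ^ 2)%N.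
Proof.
move=> len; rewrite /fill_cost /fill_rate.
set c := ccost _; rewrite -mulnn.
have: (n.+1 * n.+1 <= n'.+1 * n'.+1)%N by apply: leq_mul.
have: (n.+1 <= n'.+1 * n'.+1)%N by nia.
nia.
Qed.

Definition stage_rate :=
  (fill_rate work (NConst 0) Skip pivot_exp +
   fill_rate out (NVar vA) (down k1) emit_exp + 20)%N.

(** At most one pivot brings the working matrix to the size for s, and then the
    block for s, which is disjoint from those written before, receives the
    matrix. *)
Lemma runs_stage r st : (r < t)%N -> stage_inv r st ->
  runs (stage k1) st (stage_rate * N.+1 ^ 2) (stage_inv r.+1).
Proof.
move=> ltrt [n [S [[lenN /(_ ltrt) cnt_n] rst [cS redS] [es eA] swept_r]]].
have eA' := eA (ltnW ltrt).
set s := (t - r)%N in cnt_n es eA'.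
pose Q1 st' := exists S', [/\ ready (cnt s) st', cells (cnt s) st' S',
  reduces up_mx N (cnt s) S' & [/\ nvar st' vs = s, nvar st' vA = (B0 + s * D)%N
  & rarr st' out = rarr st out]].
have lecN : (cnt s <= N)%N by lia.
set cp := fill_cost work (NConst 0) Skip pivot_exp (cnt s).
set ce := fill_cost out (NVar vA) (down k1) emit_exp (cnt s).
apply: runs_le (_ : runs _ _ ((4 + (3 + cp)) + (ce + 8)) _) _; last first.
  have := leq_add (fill_cost_rate work (NConst 0) Skip pivot_exp lecN) (fill_cost_rate out (NVar vA) (down k1) emit_exp lecN).
  rewrite -/cp -/ce /stage_rate !mulnDl => le_cost.
  have : (1 <= N.+1 ^ 2)%N by rewrite expn_gt0.
  lia.
have [tst en et] := rst; have [tn ta tr] := tst.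
apply: (@runs_seq _ _ _ _ _ _ Q1).
  apply: runs_if; rewrite /= es en ta // -/cnt.
  case: ltnP => [lt_cn|le_nc]; last first.
    have eq_n : n = cnt s by lia.
    by apply: runs_sem => //; exists S; rewrite -eq_n.
  have eq_n : n = (cnt s).+1 by lia.
  apply: (@runs_seq _ _ _ _ _ _ (fun st1 => st1 = set_nvar st vn (cnt s))).
    by apply: runs_sem => //=; rewrite es ta.
  move=> st1 def1.
  have ag1 : agree [:: vn] [::] [::] st st1 by rewrite def1; apply: agree_set_nvar.
  have [n1 a1 r1] := ag1.
  have rst1 : ready (cnt s) st1.
    split; first exact: touched_trans tst ag1 isT isT isT.
      by rewrite def1.
    by rewrite a1.
  have cS1 : cells (cnt s).+1 st1 S by rewrite /cells r1 // -eq_n.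
  apply: runs_imp (runs_pivot _ rst1 cS1) _; first by lia.
  move=> st2 [[n2 a2 r2] rst2 cS2]; exists (schur (cnt s) S); split=> //.
    by apply: reduces_schur => //; [lia | rewrite -eq_n].
  by rewrite !n2 // !n1 // r2 // r1.
move=> st1 [S1 [rst1 cS1 redS1 [s1 A1 out1]]].
apply: runs_seq (runs_emit lecN rst1 cS1) _ => st2 [[n2 a2 r2] rst2 cS2 fl2].
apply: runs_sem => //; set st3 := sem _ st2.
have ag3 : agree [:: vA; vs] [::] [::] st2 st3 by apply: sem_agree.
have [n3 a3 r3] := ag3; have [tst2 en2 et2] := rst2; have [tn2 _ _] := tst2.
have stepD : (s * D = (t - r.+1) * D + D)%N.
  by rewrite addnC -mulSn /s; congr (_ * _)%N; lia.
have out3 x : rarr st3 out x = rarr st2 out x by rewrite r3.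
exists (cnt s), S1; split=> //.
- split=> // ltr1t; have := @cnt_step (t - r.+1); rewrite (_ : (t - r.+1).+1 = s); last by rewrite /s; lia.
  by apply; lia.
- split; first exact: touched_trans tst2 ag3 isT isT isT.
    by rewrite n3.
  by rewrite a3.
- split=> [|_]; first by rewrite /st3 /= /upd /= n2 // s1 /s; lia.
  by rewrite /st3 /= /upd /= (n2 vA) // A1 tn2 // -/D stepD addnA addnK.
have lecW := leq_trans lecN leNW.
rewrite A1 in fl2.
have off x : ~~ block s x -> rarr st3 out x = rarr st out x.
  move=> nb; rewrite out3 fl2 ifF ?out1 //; apply: contraNF nb.
  exact: filled_range.
have blockE s' i j : (i < W)%N -> (j < W)%N -> block s' (B0 + s' * D + i * W + j)%N.
  by move=> ltiW ltjW; rewrite /block; nia.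
have block_disj s' x : block s' x -> s' != s -> ~~ block s x.
  move=> /andP[lo hi] ne; apply/negP => /andP[lo' hi'].
  have [lt_s|le_s] := ltnP s' s.
    have : (s'.+1 * D <= s * D)%N by rewrite leq_mul2r lt_s orbT.
    by rewrite mulSn; lia.
  have : (s.+1 * D <= s' * D)%N by rewrite leq_mul2r; apply/orP; right; lia.
  by rewrite mulSn; lia.
case: swept_r => wr unch; split=> [s' s'P|x xP]; last first.
  rewrite off ?unch // => [s' s'P|]; apply: xP; rewrite /s; lia.
have [->|ne] := eqVneq s' s.
  exists S1 => // i j lti ltj; have ltjW := leq_trans ltj lecW.
  by rewrite out3 fl2 filled_cell // lti ltj /= cell_divn // cell_modn.
have [|S' redS' S'E] := wr s'; first by move: ne; rewrite /s; lia.
have lecs' : (cnt s' <= N)%N by apply: cnt_le; lia.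
exists S' => // i j lti ltj; rewrite off ?S'E //.
by apply: block_disj ne; apply: blockE; lia.
Qed.

Definition sweep_rate :=
  (fill_rate work (NConst 0) Skip (RConst 0) + up_cost + stage_rate + 100)%N.

Lemma within_up X Y Z : vj \in X -> work \in Z -> within X Y Z (up k2).
Proof.
by move=> jX wZ; rewrite /= jX andbT; apply: within_seqs => x; rewrite /= wZ.
Qed.

Lemma within_stage X Y Z : {subset [:: vA; vn; vs; vi; vj] <= X} ->
  {subset [:: out; work] <= Z} -> within X Y Z (stage k1).
Proof.
move=> sX sZ; apply: (within_sub sX (Y := [::]) _ sZ) => //.
have w : within [:: vA; vn; vs; vi; vj] [::] [:: out; work]
    (seqs (map (down_body k1) (pairs k1))) by apply: within_seqs.
by rewrite [within _ _ _ _]/= w.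
Qed.

(** The constant only depends on [k1] and [k2], hence on the dimension.  The
    summands t + 1 and N + 1 account for the overhead of empty loops and are
    absorbed later, when N is positive. *)
Lemma runs_sweep :
  runs (sweep k1 k2) st0 (sweep_rate * (t.+1 * N.+1 ^ 2 + p)) (swept t).
Proof.
apply: runs_le (_ : runs _ _ (3 + ((5 + N.+1 * 20) +
  (fill_cost work (NConst 0) Skip (RConst 0) N + (p.+1 * up_cost +
  (2 + t.+1 * (stage_rate * N.+1 ^ 2 + 1 + 6))))))%N _) _; last first.
  have := fill_cost_rate work (NConst 0) Skip (RConst 0) (leqnn N).
  rewrite /sweep_rate; set f := fill_rate _ _ _ _; set F := fill_cost _ _ _ _ _.
  move: up_cost stage_rate => u g le_F.
  have le_N : (N.+1 <= N.+1 ^ 2)%N by rewrite -mulnn leq_pmull.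
  set X := (N.+1 ^ 2)%N in le_F le_N *.
  have le_X : (X <= t.+1 * X)%N by rewrite leq_pmull.
  set Y := (t.+1 * X)%N in le_X *.
  have le_t : (t.+1 <= Y)%N by rewrite /Y leq_pmulr //; lia.
  have -> : (t.+1 * (g * X + 1 + 6) = g * Y + t.+1 * 7)%N by rewrite /Y; lia.
  have le_f : (f * X <= f * Y)%N by rewrite leq_mul2l le_X orbT.
  have le_u : (u <= u * Y)%N by rewrite leq_pmulr //; lia.
  by nia.
have tst0 : touched st0 by apply: agree_refl.
apply: (@runs_seq _ _ _ _ _ _ (fun st =>
  agree [:: vn] [::] [::] st0 st /\ nvar st vn = N)).
  by apply: runs_sem => //; split=> //; apply: sem_agree.
move=> st1 [ag1 en1]; have [_ _ r1] := ag1.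
have tst1 := touched_trans tst0 ag1 isT isT isT.
apply: runs_seq (runs_agree (X := [:: vi; vj]) (Y := [:: tab]) (Z := [:: work]) _
  (runs_table tst1 en1)) _ => // st2 [ag2 rst2].
apply: runs_seq (runs_agree (X := [:: vi; vj]) (Y := [:: tab]) (Z := [:: work]) _
  (runs_zero rst2)) _ => // st3 [ag3 [rst3 c3]].
apply: runs_seq (runs_agree (X := [:: vi; vj]) (Y := [:: tab]) (Z := [:: work]) _
  (runs_up rst3 c3)) _ => [|st4 [ag4 [rst4 c4]]]; first exact: within_up.
have [tst4 en4 et4] := rst4; have [tn4 ta4 tr4] := tst4.
have [[n2 _ o2] [n3 _ o3] [n4 _ o4] [n1 _ _]] := And4 ag2 ag3 ag4 ag1.
have out4 x : rarr st4 out x = rarr st0 out x by rewrite o4 // o3 // o2 // r1.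
have A4 : nvar st4 vA = (B0 + t * D)%N by rewrite n4 // n3 // n2 // n1.
pose st5 := set_nvar st4 vs t.
apply: (@runs_seq _ _ _ _ _ _ (fun st => st = st5)).
  by apply: runs_sem => //; rewrite /st5 /= tn4.
move=> _ ->.
have ag5 : agree [:: vs] [::] [::] st4 st5 by apply: agree_set_nvar.
have rst5 : ready N st5 by split=> //; apply: touched_trans tst4 ag5 isT isT isT.
have inv0 : stage_inv 0 st5.
  exists N, up_mx; split=> //.
  - by split=> // _; rewrite subn0 -/N leqnn leqnSn.
  - by split; [exact: c4 | apply: reduces_refl].
  - by rewrite subn0; split=> [|_]; rewrite /st5 /= /upd //= A4.
  by split=> [s|x _]; [lia | rewrite /st5 /= out4].
apply: runs_imp (@runs_for R [:: vi; vj; vn; vA; vs] [::] [:: out; work] vr _ _ t _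
  stage_inv st5 _ _ _ _ inv0 _) _.
- by apply: within_stage; apply/allP.
- by [].
- by move=> st' [n' _ _]; rewrite /= n' //; case: rst5 => [[n5 _ _] _ _]; rewrite n5.
- move=> r st' v [n [S [lec [tst' en et] cS [es eA] sw]]]; exists n, S; split=> //.
  split=> //.
  exact: touched_trans tst' (agree_set_nvar [::] [::] st' v (mem_head vr [::])) isT isT isT.
- by move=> r st' ltrt _ _; apply: runs_stage.
by move=> st' [_ [n [S []]]].
Qed.

End Sweep.

(** * Reading the input of a filtration *)

Lemma sum_pairs (R : realType) k (F : nat -> nat -> R) :
  \sum_(x <- pairs k) F x.1 x.2 = \sum_(l < k) \sum_(l' < k) F l l'.
Proof.
rewrite big_allpairs -{1}(subn0 k) -/(index_iota 0 k) big_mkord.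
by apply: eq_bigr => l _; rewrite -{1}(subn0 k) -/(index_iota 0 k) big_mkord.
Qed.

Section Filtration.
Variables (R : realType) (d : Order.disp_t) (V : finOrderType d).
Variables (q m : nat) (K : nat -> wcomplex R V) (o : nat -> seq {set V}).
Hypothesis filtK : filtration m K.
Hypothesis compK : compatible m K o.

Lemma compatible_listing t c : (1 <= t <= m)%N -> listing (K t) c (o c).
Proof.
move=> tP; have [perm_o take_o] := compK c; split; last exact: take_o.
by rewrite (perm_uniq perm_o) enum_uniq.
Qed.

Lemma filtration_simp s t : (1 <= s <= t)%N -> (t <= m)%N -> simp (K s) \subset simp (K t).
Proof. by case: filtK => _ pairK _ st tm; case: (pairK s t st tm). Qed.

Lemma filtration_weight s t x : (1 <= s <= t)%N -> (t <= m)%N ->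
  x \in simp (K s) -> weight (K s) x = weight (K t) x.
Proof. by case: filtK => _ pairK _ st tm; case: (pairK s t st tm) => _; apply. Qed.

Lemma sub_simplices s t c : (1 <= s <= t)%N -> (t <= m)%N ->
  simplices (K s) c \subset simplices (K t) c.
Proof.
move=> st tm; apply/subsetP => x; rewrite !inE => /andP[xK ->].
by rewrite (subsetP (filtration_simp st tm)).
Qed.

Lemma card_simplices_step s c : (1 <= s < m)%N ->
  (#|simplices (K s) c| <= #|simplices (K s.+1) c| <= #|simplices (K s) c|.+1)%N.
Proof.
move=> sP; rewrite subset_leq_card /=; last by apply: sub_simplices; lia.
have sAB : simp (K s) \subset simp (K s.+1) by apply: filtration_simp; lia.
have card1 : #|simp (K s.+1) :\: simp (K s)| = 1%N.
  rewrite cardsD (setIidPr sAB); case: filtK => _ _ ->; lia.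
rewrite -[X in (_ <= X)%N]addn1 -card1; apply: leq_trans (leq_card_setU _ _).1.
apply/subset_leq_card/subsetP => x; rewrite !inE => /andP[-> ->].
by case: (x \in _).
Qed.

Lemma holds_input_agree X Y Z st st' : agree X Y Z st st' -> vm \notin X ->
  [&& 0 \notin Y, 1 \notin Y, 2 \notin Y, 4 \notin Y & 5 \notin Y]%N ->
  [&& 0 \notin Z, 1 \notin Z, 2 \notin Z, 4 \notin Z & 5 \notin Z]%N ->
  holds_input q m K o st -> holds_input q m K o st'.
Proof.
move=> [n a r] mX /and5P[Y0 Y1 Y2 Y4 Y5] /and5P[Z0 Z1 Z2 Z4 Z5] [em ec ew es].
split; first by rewrite n.
- by move=> e s le_e sP; rewrite -ec // a //; move: e le_e => [|[|[|]]].
- by move=> e s le_e sP; rewrite -ew // r //; case: e le_e {sP} => [|[|[|]]].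
move=> e le_e; have := es e le_e.
by rewrite a ?r //; case: e le_e => [|[|[|]]].
Qed.

Section Input.
Variables (st : state R) (t : nat).
Hypothesis tP : (1 <= t <= m)%N.
Hypothesis inp : holds_input q m K o st.
Hypothesis et : nvar st vt = t.

Let k1 := nfacets q.+1.
Let k2 := nfacets q.+2.

Lemma input_count e s : (e <= 2)%N -> (1 <= s <= m)%N ->
  narr st (arr_count e) s = #|simplices (K s) (q + e)|.
Proof. by case: inp => _ ec _ _; apply: ec. Qed.

(** The input only contains the weights of K_m; those of K_s are the same. *)
Lemma input_weight e s i : (e <= 2)%N -> (1 <= s <= m)%N ->
  (i < #|simplices (K s) (q + e)|)%N ->
  rarr st (arr_weight e) i = weight (K s) (nth set0 (o (q + e)%N) i).
Proof.
move=> le_e sP lti; case: inp => _ _ ew _.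
have sm : (1 <= s <= m)%N /\ (m <= m)%N by rewrite leqnn.
rewrite ew // ?(filtration_weight sP (leqnn m)) //.
  by have := nth_listing (compatible_listing (q + e) sP) lti; rewrite inE => /andP[].
by apply: leq_trans lti _; apply/subset_leq_card/sub_simplices.
Qed.

Lemma input_facets e j i : (1 <= e <= 2)%N -> (j < #|simplices (K m) (q + e)|)%N ->
  (i < #|simplices (K m) (q + e).-1|)%N ->
  boundary1 R (nth set0 (o (q + e)%N) j) (nth set0 (o (q + e).-1) i) =
  \sum_(l < nfacets (q + e) | narr st (arr_row e) (j * nfacets (q + e) + l) == i)
     rarr st (arr_val e) (j * nfacets (q + e) + l)%N.
Proof.
move=> eP ltj lti; case: inp => _ _ _ /(_ e eP)/(_ (Ordinal ltj))[_ /(_ (Ordinal lti))].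
by rewrite mxE boundary_cbasis.
Qed.

Lemma input_row e j l : (1 <= e <= 2)%N -> (j < #|simplices (K m) (q + e)|)%N ->
  (l < nfacets (q + e))%N ->
  (narr st (arr_row e) (j * nfacets (q + e) + l) < #|simplices (K m) (q + e).-1|)%N.
Proof.
move=> eP ltj ltl; case: inp => _ _ _ /(_ e eP)/(_ (Ordinal ltj))[/(_ (Ordinal ltl)) + _].
by [].
Qed.

Let N := #|simplices (K t) q.+1|.
Let p := #|simplices (K t) q.+2|.

Lemma count1E s : (1 <= s <= m)%N -> narr st 1 s = #|simplices (K s) q.+1|.
Proof. by move=> sP; rewrite (@input_count 1) // addn1. Qed.

Lemma count2E s : (1 <= s <= m)%N -> narr st 2 s = #|simplices (K s) q.+2|.
Proof. by move=> sP; rewrite (@input_count 2) // addn2. Qed.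

Lemma le_card_simplices s c : (1 <= s <= m)%N ->
  (#|simplices (K s) c| <= #|simplices (K m) c|)%N.
Proof. by move=> sP; apply/subset_leq_card/sub_simplices. Qed.

(** A product of two entries of a column is the sum of the products of their stored
    coefficients. *)
Lemma up_mxE a b : (a < N)%N -> (b < N)%N ->
  up_mx k2 st a b = gram (K t) q.+1 (o q.+1) a b.
Proof.
move=> lta ltb; rewrite /up_mx et count2E // -/p /gram.
rewrite (sum_listing (compatible_listing q.+2 tP)) -/p.
apply: eq_bigr => j _; have ltj : (j < p)%N by [].
have ltjm := leq_trans ltj (le_card_simplices q.+2 tP).
have facetE i : (i < N)%N -> boundary1 R (nth set0 (o q.+2) j) (nth set0 (o q.+1) i) =
    \sum_(l < k2 | narr st 5 (j * k2 + l) == i) rarr st 5 (j * k2 + l)%N.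
  move=> lti; have ltim := leq_trans lti (le_card_simplices q.+1 tP).
  by have := @input_facets 2 j i isT; rewrite addn2 => ->.
have -> : weight (K t) (nth set0 (o q.+2) j) = rarr st 2 j.
  by have := @input_weight 2 t j isT tP; rewrite addn2 => ->.
rewrite !facetE // big_distrlr mulr_sumr /=.
rewrite (sum_pairs k2 (fun l l' => up_term k2 st j (l, l') a b)) [RHS]big_mkcond.
apply: eq_bigr => l _; rewrite mulr_sumr [X in if _ then X else _]big_mkcond.
case: ifP => [rl|rl]; last first.
  by rewrite big1 // => l' _; rewrite /up_term /= rl.
by apply: eq_bigr => l' _; rewrite /up_term /= rl.
Qed.

(** The sum over the faces in K_s may be extended to all the faces in K_m, as the
    boundary of a simplex of K_s has no coefficient outside K_s.  Expanding the
    entries of both columns then leaves, for each pair of stored coefficients,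
    the face at which their rows coincide. *)
Lemma down_mxE s i j : (1 <= s <= m)%N ->
  (i < #|simplices (K s) q.+1|)%N -> (j < #|simplices (K s) q.+1|)%N ->
  down_mx k1 st i j = \sum_(x in simplices (K s) q)
    boundary1 R (nth set0 (o q.+1) i) x * boundary1 R (nth set0 (o q.+1) j) x / weight (K s) x.
Proof.
move=> sP lti ltj; have lK := compatible_listing q.+1 sP.
have mP : (1 <= m <= m)%N by lia.
have ltim := leq_trans lti (le_card_simplices q.+1 sP).
have ltjm := leq_trans ltj (le_card_simplices q.+1 sP).
have facetE h a : (h < #|simplices (K m) q.+1|)%N -> (a < #|simplices (K m) q|)%N ->
    boundary1 R (nth set0 (o q.+1) h) (nth set0 (o q) a) =
    \sum_(l < k1 | narr st 4 (h * k1 + l) == a) rarr st 4 (h * k1 + l)%N.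
  by move=> lth lta; have := @input_facets 1 h a isT; rewrite addn1 => ->.
have rowE h l : (h < #|simplices (K m) q.+1|)%N -> (l < k1)%N ->
    (narr st 4 (h * k1 + l) < #|simplices (K m) q|)%N.
  by move=> lth ltl; have := @input_row 1 h l isT; rewrite addn1; apply.
transitivity (\sum_(x in simplices (K m) q)
    boundary1 R (nth set0 (o q.+1) i) x * boundary1 R (nth set0 (o q.+1) j) x / weight (K m) x);
  last first.
  rewrite [LHS]big_mkcond [RHS]big_mkcond; apply: eq_bigr => x _.
  have [xK|xK] := boolP (x \in simplices (K s) q).
    rewrite (subsetP (sub_simplices q sP (leqnn m))) // (filtration_weight sP) //.
    by move: xK; rewrite inE => /andP[].
  by rewrite (boundary1_supp (nth_listing lK lti) xK) !mul0r if_same.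
rewrite (sum_listing (compatible_listing q mP)).
rewrite /down_mx (sum_pairs k1 (fun l l' => down_term k1 st i j (l, l'))).
under [RHS]eq_bigr => a _.
  rewrite !facetE // big_distrlr mulr_suml big_mkcond /=; over.
rewrite [RHS]exchange_big; apply: eq_bigr => l _ /=.
(* The only face that pairs with coefficient l of column i is its own row. *)
pose a0 := Ordinal (rowE i l ltim (ltn_ord l)).
rewrite [RHS](bigD1 a0) //= eqxx [X in _ = _ + X]big1 ?addr0; last first.
  by move=> a ne; rewrite ifF //; apply: contraNF ne => /eqP ea; rewrite -val_eqE /= ea.
rewrite mulr_suml [RHS]big_mkcond; apply: eq_bigr => l' _; rewrite /down_term /=.
rewrite eq_sym; case: eqP => // _; congr (_ / _).
by have := @input_weight 0 m a0 isT mP; rewrite addn0 => ->.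
Qed.

Lemma written_holds B0 W D s st' : W = nvar st vW -> D = nvar st vD ->
  (1 <= s <= t)%N -> written k1 k2 st B0 s st' ->
  holds_matrix st' (B0 + s * D) W (laplacian_mx q (K s) (K t) (o q.+1)).
Proof.
move=> -> -> st_ [S redS outE] i j.
have tm : (t <= m)%N by lia.
have sP : (1 <= s <= m)%N by lia.
rewrite et !count1E // -/N in redS outE.
have lti := ltn_ord i; have ltj := ltn_ord j.
rewrite outE // /entry_mx (@down_mxE s) //.
have redS' := reduces_gram (fun a b lta ltb => esym (up_mxE lta ltb)) redS.
have [_ pairK _] := filtK.
rewrite (laplacian_mxE i j (pairK s t st_ tm) (compatible_listing q.+1 sP)
  (compatible_listing q.+1 tP) redS').
have weightE (h : 'I_#|simplices (K s) q.+1|) :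
  rarr st 1 h = weight (K s) (nth set0 (o q.+1) h).
  by have := @input_weight 1 s h isT sP; rewrite addn1 => ->.
by rewrite !weightE.
Qed.

(** The matrix for s is written at [B0 + s * D]: [B0] = 0 and D = N^2 serve the
    first algorithm, and the second one, with [B0] = t N^2 and D = (m+1) N^2,
    interleaves the outputs of its sweeps. *)
Lemma runs_sweep_input B0 : (N <= nvar st vW)%N ->
  (nvar st vW * nvar st vW <= nvar st vD)%N ->
  nvar st vA = (B0 + t * nvar st vD)%N ->
  runs (sweep k1 k2) st (sweep_rate k1 k2 * (t.+1 * N.+1 ^ 2 + p))
    (fun st' =>
      (forall s, (1 <= s <= t)%N -> holds_matrix st' (B0 + s * nvar st vD)
          (nvar st vW) (laplacian_mx q (K s) (K t) (o q.+1))) /\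
      (forall x, (forall s, (1 <= s <= t)%N -> ~~ block st B0 s x) ->
         rarr st' out x = rarr st out x)).
Proof.
move=> leNW leWD A0; have tm : (t <= m)%N by lia.
pose w k := weight (K t) (nth set0 (o q.+2) k).
pose b i k := boundary1 R (nth set0 (o q.+2) k) (nth set0 (o q.+1) i).
have upE i j : (i < N)%N -> (j < N)%N ->
    up_mx k2 st i j = \sum_(k < p) w k * (b i k * b j k).
  move=> lti ltj; rewrite up_mxE // /gram.
  by rewrite (sum_listing (compatible_listing q.+2 tP)).
have w_ge0 k : (k < p)%N -> 0 <= w k.
  move=> ltk; apply/ltW/weight_gt0.
  by have := nth_listing (compatible_listing q.+2 tP) ltk; rewrite inE => /andP[].
have sym_up : msym N (up_mx k2 st).
  move=> i j lti ltj; rewrite !upE //; apply: eq_bigr => k _.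
  by congr (_ * _); rewrite mulrC.
have iso_up := gram_null_isotropic w_ge0 upE.
have step s : (0 < s < t)%N ->
    (narr st 1 s <= narr st 1 s.+1 <= (narr st 1 s).+1)%N.
  move=> sP; rewrite !count1E; try lia.
  by apply: card_simplices_step; lia.
have := @runs_sweep R k1 k2 st; cbv zeta.
rewrite et count1E // count2E // -/N -/p => run.
apply: runs_imp (run leNW leWD step sym_up iso_up B0 A0) _.
move=> st' [wr unch]; rewrite -/k2 et subnn in wr unch; split=> // s sP.
by apply: written_holds => //; apply: wr.
Qed.

End Input.
End Filtration.

(** * Assembling the two algorithms *)

(** Multiplication by repeated addition; it is only applied to a first factor that
    is affordable as a running time. *)
Definition mult z e y :=
  Seq (NSet z (NConst 0)) (For vc e (NSet z (NAdd (NVar z) y))).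

Lemma runs_mult (R : realType) z e y a b (st : state R) : z != vc ->
  (forall st', agree [:: vc; z] [::] [::] st st' -> neval st' e = a /\ neval st' y = b) ->
  runs (mult z e y) st (2 + a.+1 * (ncost y + 3 + ncost e + 6))
    (fun st' => agree [:: vc; z] [::] [::] st st' /\ nvar st' z = (a * b)%N).
Proof.
move=> nez valE.
pose st1 := set_nvar st z 0.
apply: (@runs_seq _ _ _ _ _ _ (fun st' => st' = st1)); first exact: runs_sem.
have zX : z \in [:: vc; z] by rewrite !inE eqxx orbT.
have ag1 : agree [:: vc; z] [::] [::] st st1 by apply: agree_set_nvar.
move=> _ ->; apply: runs_imp (@runs_for R [:: z] [::] [::] vc e _ a _
  (fun i st' => nvar st' z = i * b)%N st1 _ _ _ _ _ _) _.
- by rewrite /= mem_head.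
- by rewrite inE eq_sym.
- by move=> st2 ag2; case: (valE st2 (agree_trans ag1 ag2)).
- by move=> i st2 v; rewrite /= /upd (negPf nez).
- by rewrite /= /upd eqxx.
- move=> i st2 ltia ag2 _ z2; apply: runs_sem => //=; first by lia.
  by rewrite /upd eqxx z2 mulSn addnC; case: (valE st2 (agree_trans ag1 ag2)) => _ ->.
by move=> st2 [ag2 z2]; split=> //; apply: agree_trans ag2.
Qed.

Lemma within_sweep k1 k2 X : {subset sweep_vars <= X} ->
  within X [:: tab] [:: out; work] (sweep k1 k2).
Proof.
move=> sX; apply: (within_sub (X := sweep_vars) (Y := [:: tab]) (Z := [:: out; work]) sX) => //.
have wu := @within_up k2 sweep_vars [:: tab] [:: out; work] isT isT.
have ws := @within_stage k1 sweep_vars [:: tab] [:: out; work].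
rewrite /sweep /For; rewrite [within _ _ _ _]/=.
move: wu; rewrite /up /For [within _ _ _ _]/= => ->.
have := ws; rewrite [within _ _ _ _]/= => -> //; apply/allP => //.
Qed.

(** Without q-simplices nothing has to be written, and the loop over s must be
    avoided, because its length t is not bounded by a constant. *)
Definition one_time k1 k2 :=
  Seq (NSet vW (NGet 1 (NVar vt)))
    (If (NLt (NConst 0) (NVar vW))
       (Seq (mult vD (NVar vW) (NVar vW))
          (Seq (mult vA (NVar vt) (NVar vD)) (sweep k1 k2)))
       Skip).

(** A sweep destroys its output address, so it is recomputed for each t. *)
Definition all_times_body k1 k2 :=
  Seq (NSet vt (NAdd (NVar vl) (NConst 1)))
    (Seq (mult vA (NVar vt) (NAdd (NVar vE) (NVar vD))) (sweep k1 k2)).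

Definition all_times k1 k2 :=
  Seq (NSet vW (NGet 1 (NVar vm)))
    (If (NLt (NConst 0) (NVar vW))
       (Seq (mult vE (NVar vW) (NVar vW))
          (Seq (mult vD (NAdd (NVar vm) (NConst 1)) (NVar vE))
            (For vl (NVar vm) (all_times_body k1 k2))))
       Skip).

Lemma sq_succ_le N : (0 < N)%N -> (N.+1 ^ 2 <= 4 * N ^ 2)%N.
Proof. by move=> N_gt0; rewrite -!mulnn; nia. Qed.

(** Here positivity of N is essential: it turns t into a lower bound of t N^2. *)
Lemma sweep_size_le t N p : (0 < t)%N -> (0 < N)%N ->
  (t.+1 * N.+1 ^ 2 + p <= 8 * (t * N ^ 2 + p))%N.
Proof.
move=> t_gt0 N_gt0; have le_t : (t.+1 <= 2 * t)%N by lia.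
have := leq_mul le_t (sq_succ_le N_gt0); lia.
Qed.

Lemma one_time_correct (q : nat) (R : realType) (d : Order.disp_t) (V : finOrderType d)
    (m : nat) (K : nat -> wcomplex R V) (o : nat -> seq {set V}) (t : nat) (st : state R) :
  filtration m K -> compatible m K o -> (1 <= t <= m)%N ->
  holds_input q m K o st -> nvar st var_t = t ->
  let N := #|simplices (K t) q.+1| in
  runs (one_time (nfacets q.+1) (nfacets q.+2)) st
    ((8 * sweep_rate (nfacets q.+1) (nfacets q.+2) + 100)
      * maxn 1 (t * N ^ 2 + #|simplices (K t) q.+2|))
    (fun st' => forall s, (1 <= s <= t)%N ->
       holds_matrix st' (s * N * N) N (laplacian_mx q (K s) (K t) (o q.+1))).
Proof.
move=> filtK compK tP inp et N.
set k1 := nfacets q.+1; set k2 := nfacets q.+2; set p := #|simplices _ _|.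
set B := (_ * _)%N.
have B_ge : (100 <= B)%N by rewrite /B -[100%N]muln1 leq_mul //; lia.
pose st1 := set_nvar st vW N.
have cntN : narr st 1 (nvar st 1) = N by rewrite et (count1E inp).
apply: runs_le (_ : runs _ _ (3 + (3 + (B - 6))) _) _; last by lia.
apply: (@runs_seq _ _ _ _ _ _ (fun st' => st' = st1)).
  by apply: runs_sem => //; rewrite /= cntN.
move=> _ ->; apply: runs_if; rewrite /= /upd /=.
have [N_gt0|] := ltnP 0 N; last first.
  rewrite leqn0 => /eqP N0; apply: runs_sem => // s st_ i.
  have : (#|simplices (K s) q.+1| <= 0)%N.
    by rewrite -N0; apply/subset_leq_card/(sub_simplices filtK); lia.
  by move=> le0; have := leq_trans (ltn_ord i) le0.
have N_le : (N <= t * N ^ 2 + p)%N.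
  have : (N <= N * N)%N by rewrite leq_pmull.
  have : (N ^ 2 <= t * N ^ 2)%N by rewrite leq_pmull; lia.
  rewrite -mulnn; lia.
have t_le : (t <= t * N ^ 2 + p)%N.
  have : (t * 1 <= t * N ^ 2)%N by rewrite leq_mul2l expn_gt0 N_gt0 orbT.
  lia.
apply: runs_le (_ : runs _ _ ((2 + N.+1 * 11) + ((2 + t.+1 * 11) +
   sweep_rate k1 k2 * (t.+1 * N.+1 ^ 2 + p))) _) _; last first.
  have t_gt0 : (0 < t)%N by lia.
  have le_s := sweep_size_le p t_gt0 N_gt0.
  have := leq_mul (leqnn (sweep_rate k1 k2)) le_s.
  rewrite /B (maxn_idPr _); last by lia.
  set f := (t * N ^ 2 + p)%N in N_le t_le *.
  set g := (_ + p)%N; move: (sweep_rate k1 k2) => r; nia.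
apply: runs_seq (runs_mult (a := N) (b := N) _ _) _ => //.
  by move=> st2 [n2 _ _]; rewrite /= n2.
move=> st2 [[n2 a2 r2] D2].
apply: runs_seq (runs_mult (a := t) (b := (N * N)%N) _ _) _ => //.
  by move=> st3 [n3 _ _]; rewrite /= !n3 // n2 // D2 /= /upd /= et.
move=> st3 [[n3 a3 r3] A3].
have inp3 : holds_input q m K o st3.
  apply: (@holds_input_agree _ _ _ q m K o [:: vW; vD; vA; vc] [::] [::] st) => //.
  split=> x xX; last by rewrite r3 // r2.
    have [xW xD xA xc] : [/\ x != vW, x != vD, x != vA & x != vc].
      by move: xX; rewrite !inE !negb_or => /and4P.
    by rewrite n3 ?n2 ?inE ?negb_or ?xD ?xA ?xc //= /upd (negPf xW).
  by rewrite a3 // a2.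
have W3 : nvar st3 vW = N by rewrite n3 // n2.
have D3 : nvar st3 vD = (N * N)%N by rewrite n3 // D2.
have t3 : nvar st3 vt = t by rewrite n3 // n2 //= /upd /= et.
apply: runs_imp (runs_sweep_input (B0 := 0) filtK compK tP inp3 t3 _ _ _) _.
- by rewrite W3.
- by rewrite W3 D3.
- by rewrite A3 D3.
by move=> st4 [H _] s sP; have := H s sP; rewrite W3 D3 add0n mulnA.
Qed.

Lemma all_times_correct (q : nat) (R : realType) (d : Order.disp_t) (V : finOrderType d)
    (m : nat) (K : nat -> wcomplex R V) (o : nat -> seq {set V}) (st : state R) :
  filtration m K -> compatible m K o -> holds_input q m K o st ->
  let N := #|simplices (K m) q.+1| in
  runs (all_times (nfacets q.+1) (nfacets q.+2)) st
    ((16 * sweep_rate (nfacets q.+1) (nfacets q.+2) + 200)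
      * maxn 1 (m ^ 2 * N ^ 2 + m * #|simplices (K m) q.+2|))
    (fun st' => forall i j, (1 <= i <= j)%N -> (j <= m)%N ->
       holds_matrix st' ((i * m.+1 + j) * N * N) N
         (laplacian_mx q (K i) (K j) (o q.+1))).
Proof.
move=> filtK compK inp N.
have m_gt0 : (0 < m)%N by case: filtK.
have mP : (1 <= m <= m)%N by lia.
set k1 := nfacets q.+1; set k2 := nfacets q.+2; set p := #|simplices _ _|.
set B := (_ * _)%N.
have B_ge : (200 <= B)%N by rewrite /B -[200%N]muln1 leq_mul //; lia.
have em : nvar st vm = m by case: inp.
pose st1 := set_nvar st vW N.
have cntN : narr st 1 (nvar st 0) = N by rewrite em (count1E inp).
apply: runs_le (_ : runs _ _ (3 + (3 + (B - 6))) _) _; last by lia.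
apply: (@runs_seq _ _ _ _ _ _ (fun st' => st' = st1)).
  by apply: runs_sem => //; rewrite /= cntN.
move=> _ ->; apply: runs_if; rewrite /= /upd /=.
have [N_gt0|] := ltnP 0 N; last first.
  rewrite leqn0 => /eqP N0; apply: runs_sem => // i j ij jm a.
  have : (#|simplices (K i) q.+1| <= 0)%N.
    by rewrite -N0; apply/subset_leq_card/(sub_simplices filtK); lia.
  by move=> le0; have := leq_trans (ltn_ord a) le0.
set r := sweep_rate k1 k2.
pose b := (6 + m.+1 * 13 + r * (8 * (m * N ^ 2 + p)))%N.
apply: runs_le (_ : runs _ _ ((2 + N.+1 * 11) + ((2 + m.+2 * 13) +
   m.+1 * (b + 1 + 6))) _) _; last first.
  have N_le : (N <= N ^ 2)%N by rewrite -mulnn leq_pmull.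
  have m_le : (m <= m ^ 2)%N by rewrite -mulnn leq_pmull.
  have NN_gt0 : (0 < N ^ 2)%N by lia.
  have mmNN : (m ^ 2 <= m ^ 2 * N ^ 2)%N by rewrite leq_pmulr.
  have NNmm : (N ^ 2 <= m ^ 2 * N ^ 2)%N by rewrite leq_pmull //; lia.
  rewrite /B (maxn_idPr _); last by lia.
  set f := (m ^ 2 * N ^ 2 + m * p)%N.
  have f_m : (m.+1 * (8 * (m * N ^ 2 + p)) <= 16 * f)%N.
    rewrite /f (_ : 16 * _ = (2 * m) * (8 * (m * N ^ 2 + p)))%N; last first.
      by rewrite -(mulnn m); lia.
    by rewrite leq_mul2r; lia.
  have f_m2 : (m ^ 2 <= f)%N by rewrite /f; lia.
  have f_N : (N <= f)%N by rewrite /f; lia.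
  have m2 : (m.+1 * m.+1 <= 4 * f)%N.
    by have := sq_succ_le m_gt0; rewrite -mulnn; lia.
  have := leq_mul (leqnn r) f_m; rewrite mulnCA [(r * (16 * f))%N]mulnA [(r * 16)%N]mulnC.
  rewrite /b; set X := (r * _)%N; set Y := (16 * r)%N; move=> HX.
  have -> : (m.+1 * (6 + m.+1 * 13 + X + 1 + 6) =
     m.+1 * 13 + 13 * (m.+1 * m.+1) + m.+1 * X)%N by lia.
  have : ((Y + 200) * f = Y * f + 200 * f)%N by rewrite mulnDl.
  lia.
apply: runs_seq (runs_mult (a := N) (b := N) _ _) _ => //.
  by move=> st2 [n2 _ _]; rewrite /= n2.
move=> st2 [[n2 a2 r2] E2].
apply: runs_seq (runs_mult (a := m.+1) (b := (N * N)%N) _ _) _ => //.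
  by move=> st3 [n3 _ _]; rewrite /= !n3 // n2 // E2 /= /upd /= em addn1.
move=> st3 [[n3 a3 r3] D3].
have m3 : nvar st3 vm = m by rewrite n3 // n2.
have W3 : nvar st3 vW = N by rewrite n3 // n2.
have E3 : nvar st3 vE = (N * N)%N by rewrite n3.
have inp3 : holds_input q m K o st3.
  apply: (@holds_input_agree _ _ _ q m K o [:: vW; vD; vE; vc] [::] [::] st) => //.
  split=> x xX; last by rewrite r3 // r2.
    have [xW xD xE xc] : [/\ x != vW, x != vD, x != vE & x != vc].
      by move: xX; rewrite !inE !negb_or => /and4P.
    by rewrite n3 ?n2 ?inE ?negb_or ?xD ?xE ?xc //= /upd (negPf xW).
  by rewrite a3 // a2.
pose X := [:: vt; vc; vA; vn; vs; vi; vj; vr].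
have wb : within X [:: tab] [:: out; work] (all_times_body k1 k2).
  have ws : within X [:: tab] [:: out; work] (sweep k1 k2).
    by apply: within_sweep; apply/allP.
  exact: (introT andP (conj isT (introT andP (conj isT ws)))).
pose I l (st' : state R) := forall i j, (1 <= i <= j)%N -> (j <= l)%N ->
  holds_matrix st' ((i * m.+1 + j) * N * N) N (laplacian_mx q (K i) (K j) (o q.+1)).
apply: runs_imp (@runs_for R X [:: tab] [:: out; work] vl (NVar vm) _ m b I st3
  wb _ _ _ _ _) _ => //; last by move=> st4 [].
- by move=> st4 [n4 _ _]; rewrite /= n4.
- by move=> i j ij; lia.
move=> l st4 ltlm ag4 l4 I4; have [n4 a4 r4] := ag4.
have inp4 : holds_input q m K o st4 by apply: holds_input_agree ag4 _ _ _ inp3.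
have m4 : nvar st4 vm = m by rewrite n4.
have W4 : nvar st4 vW = N by rewrite n4.
have E4 : nvar st4 vE = (N * N)%N by rewrite n4.
have D4 : nvar st4 vD = (m.+1 * (N * N))%N by rewrite n4.
pose t := l.+1; have tP : (1 <= t <= m)%N by [].
have leNt : (#|simplices (K t) q.+1| <= N)%N := le_card_simplices filtK q.+1 tP.
have lept : (#|simplices (K t) q.+2| <= p)%N := le_card_simplices filtK q.+2 tP.
pose st5 := set_nvar st4 vt t.
apply: runs_le (_ : runs _ _ (4 + ((2 + t.+1 * 13) + r * (t.+1 * (#|simplices (K t) q.+1|).+1 ^ 2
   + #|simplices (K t) q.+2|))) _) _; last first.
  rewrite /b addnA; apply: leq_add; first by rewrite /t; lia.
  rewrite leq_mul2l; apply/orP; right.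
  apply: leq_trans (sweep_size_le p m_gt0 N_gt0).
  apply: leq_add lept; apply: leq_mul; first by rewrite /t; lia.
  by rewrite leq_exp2r.
apply: (@runs_seq _ _ _ _ _ _ (fun st' => st' = st5)).
  by apply: runs_sem => //; rewrite /= l4 addn1.
move=> _ ->.
apply: runs_seq (runs_mult (a := t) (b := (N * N + m.+1 * (N * N))%N) _ _) _ => //.
  by move=> st6 [n6 _ _]; rewrite /= !n6 // /st5 /= /upd /= D4 E4.
move=> st6 [ag6 A6]; have [n6 a6 r6] := ag6.
have W6 : nvar st6 vW = N by rewrite n6.
have D6 : nvar st6 vD = (m.+1 * (N * N))%N by rewrite n6.
have t6 : nvar st6 vt = t by rewrite n6.
have inp6 : holds_input q m K o st6.
  have inp5 : holds_input q m K o st5.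
    by apply: (@holds_input_agree _ _ _ q m K o [:: vt] [::] [::] st4) => //; apply: agree_set_nvar.
  by apply: holds_input_agree ag6 _ _ _ inp5.
apply: runs_imp (runs_sweep_input (B0 := t * (N * N)) filtK compK tP inp6 t6 _ _ _) _.
- by rewrite W6.
- by rewrite W6 D6 leq_pmull.
- by rewrite A6 D6 mulnDr.
move=> st7 [new7 old7] i j ij; rewrite leq_eqVlt ltnS => /predU1P[eq_j|le_jl].
  have ij' : (1 <= i <= t)%N by rewrite /t -eq_j.
  rewrite eq_j -/t; have := new7 i ij'; rewrite W6 D6.
  by rewrite (_ : t * (N * N) + i * (m.+1 * (N * N)) = (i * m.+1 + t) * N * N)%N //; lia.
move=> a c; rewrite old7; first by rewrite r6 // I4.
have lti : (#|simplices (K i) q.+1| <= N)%N by apply: (le_card_simplices filtK q.+1); lia.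
have := ltn_ord a; have := ltn_ord c => ltc lta s sP.
apply/negP; rewrite /block W6 D6.
set x := (_ * N * N + a * N + c)%N.
have x_lo : ((i * m.+1 + j) * (N * N) <= x)%N by rewrite /x mulnA -addnA leq_addr.
have x_hi : (x < (i * m.+1 + j).+1 * (N * N))%N.
  rewrite mulSn /x mulnA [(N * N + _)%N]addnC -addnA ltn_add2l.
  have : (a.+1 * N <= N * N)%N by rewrite leq_mul2r; lia.
  by rewrite mulSn; lia.
have -> : (t * (N * N) + s * (m.+1 * (N * N)) = (s * m.+1 + t) * (N * N))%N by lia.
rewrite [(_ * _ + N * N)%N]addnC -mulSn => /andP[lo hi].
have NN_gt0 : (0 < N * N)%N by rewrite muln_gt0 N_gt0.
have : ((i * m.+1 + j) * (N * N) < (s * m.+1 + t).+1 * (N * N))%N by lia.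
have : ((s * m.+1 + t) * (N * N) < (i * m.+1 + j).+1 * (N * N))%N by lia.
rewrite !ltn_pmul2r // !ltnS => le1 le2.
(* Overlapping blocks have the same number; its last digit in base m + 1
   would then be both t and j. *)
have eq_ad : (s * m.+1 + t = i * m.+1 + j)%N by lia.
have lt_t : (t < m.+1)%N by lia.
have lt_j : (j < m.+1)%N by lia.
have := congr1 (modn^~ m.+1) eq_ad; rewrite /= !modnMDl !modn_small //.
by rewrite /t; lia.
Qed.

Theorem theorem5p1 (q : nat) :
  (exists (P : com) (C : nat),
     forall (R : realType) (d : Order.disp_t) (V : finOrderType d)
       (m : nat) (K : nat -> wcomplex R V) (o : nat -> seq {set V})
       (t : nat) (st : state R),
     filtration m K -> compatible m K o -> (1 <= t <= m)%N ->
     holds_input q m K o st -> nvar st var_t = t ->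
     let N := #|simplices (K t) q.+1| in
     exists (k : nat) (st' : state R),
       [/\ exec P st k st',
           time_bound C (t * N ^ 2 + #|simplices (K t) q.+2|)%N k
         & forall s : nat, (1 <= s <= t)%N ->
             holds_matrix st' (s * N * N) N
               (laplacian_mx q (K s) (K t) (o q.+1))])
  /\
  (exists (P : com) (C : nat),
     forall (R : realType) (d : Order.disp_t) (V : finOrderType d)
       (m : nat) (K : nat -> wcomplex R V) (o : nat -> seq {set V})
       (st : state R),
     filtration m K -> compatible m K o -> holds_input q m K o st ->
     let N := #|simplices (K m) q.+1| in
     exists (k : nat) (st' : state R),
       [/\ exec P st k st',
           time_bound C (m ^ 2 * N ^ 2 + m * #|simplices (K m) q.+2|)%N k
         & forall i j : nat, (1 <= i <= j)%N -> (j <= m)%N ->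
             holds_matrix st' ((i * m.+1 + j) * N * N) N
               (laplacian_mx q (K i) (K j) (o q.+1))]).
Proof.
split.
  exists (one_time (nfacets q.+1) (nfacets q.+2)).
  exists (8 * sweep_rate (nfacets q.+1) (nfacets q.+2) + 100)%N.
  move=> R d V m K o t st filtK compK tP inp et.
  exact: (one_time_correct filtK compK tP inp et).
exists (all_times (nfacets q.+1) (nfacets q.+2)).
exists (16 * sweep_rate (nfacets q.+1) (nfacets q.+2) + 200)%N.
move=> R d V m K o st filtK compK inp.
exact: (all_times_correct filtK compK inp).
Qed.
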